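(* Let $I_{\mathcal{L}}$ be a lattice ideal and let $(\mathbf{F}_\bullet,\phi,\mathbf{B})$ be a strongly indispensable complex of $R/I_{\mathcal{L}}$. Let $\mathbf{B}=(B_j)$, let $i\ge0$, $E\in B_{i+1}$ and $\mathbf{b}=\deg_{\mathcal{A}}(E)$. Then $\dim_{\Bbbk}\tilde{H}_i(\Delta_{\gcd}(\mathbf{b});\Bbbk)=1$ and $\mathbf{b}$ is a minimal $(i+1)$-Betti degree of $R/I_{\mathcal{L}}$.
   Context: Setting. Let $\mathcal{L}\subset\mathbb{Z}^n$ be a lattice (subgroup) with $\mathcal{L}\cap\mathbb{N}^n=\{\mathbf{0}\}$, and let $\mathcal{A}$ be the subsemigroup (containing $0$) of $\mathbb{Z}^n/\mathcal{L}$ generated by $\mathbf{a}_i=\mathbf{e}_i+\mathcal{L}$, $1\le i\le n$, where $\mathbf e_1,\dots,\mathbf e_n$ is the canonical basis of $\mathbb{Z}^n$. $\mathcal{A}$ is partially ordered by $\mathbf{c}\ge\mathbf{d}$ iff $\mathbf{c}=\mathbf{d}+\mathbf{e}$ for some $\mathbf{e}\in\mathcal{A}$. Let $\Bbbk$ be a field and $R=\Bbbk[x_1,\dots,x_n]$, multigraded by $\mathcal{A}$ via $\deg_{\mathcal{A}}(\mathbf{x}^{\mathbf{v}})=v_1\mathbf{a}_1+\cdots+v_n\mathbf{a}_n$. The lattice ideal $I_{\mathcal{L}}$ is generated by all binomials $\mathbf{x}^{\mathbf{u}_+}-\mathbf{x}^{\mathbf{u}_-}$ with $\mathbf{u}_+,\mathbf{u}_-\in\mathbb{N}^n$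 and $\mathbf{u}_+-\mathbf{u}_-\in\mathcal{L}$. Betti degrees. $\beta_{i,\mathbf{b}}(R/I)=\dim_{\Bbbk}\operatorname{Tor}_i^R(R/I,\Bbbk)_{\mathbf{b}}$. The $i$-Betti degrees of $R/I$ are the $\mathbf{b}\in\mathcal{A}$ with $\beta_{i,\mathbf{b}}(R/I)\ne0$; the minimal $i$-Betti degrees are the minimal elements (for $\geq$) of the set of $i$-Betti degrees. gcd-complex. For $\mathbf{b}\in\mathcal{A}$, $C_{\mathbf{b}}=\{\mathbf{x}^{\mathbf{u}}:\deg_{\mathcal{A}}(\mathbf{x}^{\mathbf{u}})=\mathbf{b}\}$ (a finite set), and $\Delta_{\gcd}(\mathbf{b})$ is the simplicial complex on vertex set $C_{\mathbf{b}}$ whose faces are the empty set and all nonempty subsets $T\subset C_{\mathbf{b}}$ with $\gcd(\mathbf{x}^{\mathbf{a}}:\mathbf{x}^{\mathbf{a}}\in T)\neq1$. $\tilde H_j$ denotes reduced simplicial homology. Based complexes. Complexes are $\mathcal{A}$-homogeneous: finite rank $\mathcal{A}$-graded free $R$-modules with degree-preserving maps. A minimal free resolution of $R/I$ is an exact complex $0\to G_p\xrightarrow{\theta_p}\cdots\to G_1\xrightarrow{\theta_1}G_0=R\xrightarrow{\theta_0}R/I\to0$ of this kind with $\theta_i(G_i)\subset(x_1,\dots,x_n)G_{i-1}$ for $i\ge1$. A based complex $(\mathbf{G}_\bullet,\theta,\mathbf{C})$ is an $\mathcal{A}$-homogeneous complex with a system of bases $\mathbf{C}=(C_i)$, $C_i$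 an $\mathcal{A}$-homogeneous basis of $G_i$. A complex homomorphism $\omega$ from $(\mathbf{F}_\bullet,\phi,\mathbf{B})$ to $(\mathbf{G}_\bullet,\theta,\mathbf{C})$ is a based homomorphism if for each $i$ and each $E\in B_i$ there are $H\in C_i$ and $c\in\Bbbk^*$ with $\omega(E)=cH$. Strongly indispensable complex. A based complex $(\mathbf{F}_\bullet,\phi,\mathbf{B})$ is a strongly indispensable complex of $R/I$ if for every based minimal free resolution $(\mathbf{G}_\bullet,\theta,\mathbf{C})$ of $R/I$ with $C_0=\{1\}$ there is an injective based homomorphism $\omega:(\mathbf{F}_\bullet,\phi,\mathbf{B})\to(\mathbf{G}_\bullet,\theta,\mathbf{C})$ with $\omega_0=\mathrm{id}_R$. *)

(* Defs.v *)
From HB Require Import structures.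
From mathcomp Require Import all_boot all_order all_algebra.
From mathcomp Require Import generic_quotient ring_quotient finmap.
From mathcomp Require Import mpoly.

Set Implicit Arguments.
Unset Strict Implicit.
Unset Printing Implicit Defensive.

Import GRing.Theory.
Local Open Scope ring_scope.

(* A lattice L is a boolean predicate closed under subtraction; this loses no *)
(* generality, as every subgroup of Z^n is finitely generated and so has      *)
(* decidable membership.                                                      *)

Definition pointed_lattice (n : nat) (L : zmodClosed 'rV[int]_n) : Prop :=
  forall v : 'rV[int]_n, v \in L -> (forall j, 0 <= v 0 j) -> v = 0.

Definition lattice_quot (n : nat) (L : zmodClosed 'rV[int]_n) : zmodType :=
  {ideal_quot L}.

Definition gen_deg (n : nat) (L : zmodClosed 'rV[int]_n) (i : 'I_n) :
    lattice_quot L :=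
  (\pi_{ideal_quot L} (delta_mx 0 i : 'rV[int]_n))%qT.

Definition mdegA (n : nat) (L : zmodClosed 'rV[int]_n) (u : 'X_{1..n}) :
    lattice_quot L :=
  \sum_(i < n) gen_deg L i *+ u i.

Definition in_semigroup (n : nat) (L : zmodClosed 'rV[int]_n)
    (c : lattice_quot L) : Prop :=
  exists u : 'X_{1..n}, c = mdegA L u.

Definition leA (n : nat) (L : zmodClosed 'rV[int]_n)
    (d c : lattice_quot L) : Prop :=
  exists2 e : lattice_quot L, in_semigroup e & c = d + e.

Definition ideal_gen (R : comNzRingType) (S : R -> Prop) (p : R) : Prop :=
  exists2 s : seq (R * R),
    (forall q, q \in s -> S q.2) & p = \sum_(q <- s) q.1 * q.2.

Definition irrelevant_ideal (k : fieldType) (n : nat) : {mpoly k[n]} -> Prop :=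
  ideal_gen (fun p => exists l : 'I_n, p = 'X_l).

Definition exponent_vector (n : nat) (u : 'X_{1..n}) : 'rV[int]_n :=
  \row_j (u j)%:Z.

Definition lattice_ideal (k : fieldType) (n : nat) (L : zmodClosed 'rV[int]_n) :
    {mpoly k[n]} -> Prop :=
  ideal_gen (fun p => exists u v : 'X_{1..n},
    exponent_vector u - exponent_vector v \in L /\ p = 'X_[u] - 'X_[v]).

(* A free module R(-d_0) + ... + R(-d_(r-1)) is represented by 'rV[R]_r       *)
(* together with the shifts d; [homog_elt d c v] says that v is homogeneous of    *)
(* degree c for this grading.  Maps act on the right of row vectors.          *)

Definition homog_elt (k : fieldType) (n : nat) (L : zmodClosed 'rV[int]_n) (r : nat)
    (d : 'I_r -> lattice_quot L) (c : lattice_quot L)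
    (v : 'rV[{mpoly k[n]}]_r) : Prop :=
  forall j m, m \in msupp (v 0 j) -> mdegA L m + d j = c.

Definition homog_map (k : fieldType) (n : nat) (L : zmodClosed 'rV[int]_n)
    (r s : nat) (d : 'I_r -> lattice_quot L) (d' : 'I_s -> lattice_quot L)
    (M : 'M[{mpoly k[n]}]_(r, s)) : Prop :=
  forall a, homog_elt d' (d a) (row a M).

Record graded_complex (k : fieldType) (n : nat) (L : zmodClosed 'rV[int]_n) :=
  GradedComplex {
    rk : nat -> nat;
    shift : forall i, 'I_(rk i) -> lattice_quot L;
    shift_in : forall i j, in_semigroup (shift (i := i) j);
    (* diff i is the map from homological degree i+1 to degree i *)
    diff : forall i, 'M[{mpoly k[n]}]_(rk i.+1, rk i);
    diff_homog : forall i,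
      homog_map (shift (i := i.+1)) (shift (i := i)) (diff i);
    diff_diff : forall i, diff i.+1 *m diff i = 0 }.

Arguments rk {k n L} g i.
Arguments shift {k n L} g i j.
Arguments diff {k n L} g i.

(* The module in homological degree 0 is R itself, generated in degree 0.     *)
Definition starts_at_R (k : fieldType) (n : nat) (L : zmodClosed 'rV[int]_n)
    (G : graded_complex k L) : Prop :=
  rk G 0%N = 1%N /\ forall j, shift G 0%N j = 0.

(* Exactness of ... -> G_1 -> G_0 = R -> R/I -> 0, with R -> R/I canonical.   *)
Definition free_resolution (k : fieldType) (n : nat) (L : zmodClosed 'rV[int]_n)
    (I : {mpoly k[n]} -> Prop) (G : graded_complex k L) : Prop :=
  [/\ starts_at_R G,
      (forall v : 'rV[{mpoly k[n]}]_(rk G 0%N),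
         (forall j, I (v 0 j)) <-> exists w, v = w *m diff G 0%N)
    & (forall i (v : 'rV[{mpoly k[n]}]_(rk G i.+1)),
         v *m diff G i = 0 -> exists w, v = w *m diff G i.+1)].

Definition minimal_free_resolution (k : fieldType) (n : nat)
    (L : zmodClosed 'rV[int]_n) (I : {mpoly k[n]} -> Prop)
    (G : graded_complex k L) : Prop :=
  [/\ free_resolution I G,
      (exists p, forall i, (p < i)%N -> rk G i = 0%N)
    & (forall i (v : 'rV[{mpoly k[n]}]_(rk G i.+1)) j,
         irrelevant_ideal ((v *m diff G i) 0 j))].

(* Tor_i(R/I, k)_b is the homology of (G (x) k)_b for a free resolution G of  *)
(* R/I.  Tensoring with k = R/(x_1, ..., x_n) replaces the entries of the     *)
(* differentials by their constant coefficients, and (G_i (x) k)_b is spanned *)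
(* by the generators of degree b.                                             *)

Definition tensor_diff (k : fieldType) (n : nat) (L : zmodClosed 'rV[int]_n)
    (G : graded_complex k L) (i : nat) : 'M[k]_(rk G i.+1, rk G i) :=
  map_mx (fun p : {mpoly k[n]} => p@_0%MM) (diff G i).

Definition tensor_part (k : fieldType) (n : nat) (L : zmodClosed 'rV[int]_n)
    (G : graded_complex k L) (i : nat) (b : lattice_quot L) : 'M[k]_(rk G i) :=
  diag_mx (\row_j (shift G i j == b)%:R).

Definition tensor_cycles (k : fieldType) (n : nat) (L : zmodClosed 'rV[int]_n)
    (G : graded_complex k L) (i : nat) (b : lattice_quot L) : 'M[k]_(rk G i) :=
  match i with
  | 0 => tensor_part G 0 b
  | i'.+1 => (tensor_part G i'.+1 b :&: kermx (tensor_diff G i'))%MS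
  end.

Definition tensor_boundaries (k : fieldType) (n : nat)
    (L : zmodClosed 'rV[int]_n) (G : graded_complex k L) (i : nat)
    (b : lattice_quot L) : 'M[k]_(rk G i.+1, rk G i) :=
  tensor_part G i.+1 b *m tensor_diff G i.

Definition tor_dim (k : fieldType) (n : nat) (L : zmodClosed 'rV[int]_n)
    (G : graded_complex k L) (i : nat) (b : lattice_quot L) : nat :=
  (\rank (tensor_cycles G i b) - \rank (tensor_boundaries G i b))%N.

Definition betti_degree (k : fieldType) (n : nat) (L : zmodClosed 'rV[int]_n)
    (I : {mpoly k[n]} -> Prop) (i : nat) (b : lattice_quot L) : Prop :=
  in_semigroup b /\
  exists2 G : graded_complex k L, free_resolution I G & tor_dim G i b != 0%N.

Definition minimal_betti_degree (k : fieldType) (n : nat)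
    (L : zmodClosed 'rV[int]_n) (I : {mpoly k[n]} -> Prop) (i : nat)
    (b : lattice_quot L) : Prop :=
  betti_degree I i b /\
  forall c : lattice_quot L, betti_degree I i c -> leA c b -> c = b.

(* Simplicial complexes on a finite type, given by their set of faces; a      *)
(* chain of dimension j is supported on faces of cardinality j + 1, and the   *)
(* vertices are ordered by enum_rank.                                         *)

Definition faces (V : finType) (K : pred {set V}) (s : nat) : {set {set V}} :=
  [set T : {set V} | K T && (#|T| == s)].

Definition boundary_coef (k : fieldType) (V : finType) (T S : {set V}) : k :=
  \sum_(v in T | S == T :\ v)
    (-1) ^+ #|[set w in T | (enum_rank w < enum_rank v)%N]|.

Definition boundary_mx (k : fieldType) (V : finType) (K : pred {set V})
    (s : nat) : 'M[k]_(#|faces K s.+1|, #|faces K s|) :=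
  \matrix_(a, b) boundary_coef k (enum_val a) (enum_val b).

(* The dimension of cycles minus that of boundaries; the homology is reduced  *)
(* because the empty face is a face of K of cardinality 0.                    *)
Definition reduced_homology_dim (k : fieldType) (V : finType)
    (K : pred {set V}) (j : nat) : nat :=
  (\rank (kermx (boundary_mx k K j)) - \rank (boundary_mx k K j.+1))%N.

(* The gcd of the monomials in a nonempty set T; the outer maximum only       *)
(* serves as an upper bound from which to take the minimum.                   *)
Definition mgcd_set (n : nat) (V : {fset 'X_{1..n}}) (T : {set V}) :
    'X_{1..n} :=
  [multinom \big[minn/(\max_(u in T) val u i)%N]_(u in T) val u i | i < n].

Definition gcd_complex (n : nat) (V : {fset 'X_{1..n}}) : pred {set V} :=
  fun T => (T == set0) || (mgcd_set T != 0%MM).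

(* The set C of monomials of degree b is finite; it is given here with its    *)
(* specification.                                                             *)
Definition gcd_homology_dim_eq (k : fieldType) (n : nat)
    (L : zmodClosed 'rV[int]_n) (b : lattice_quot L) (j d : nat) : Prop :=
  exists2 C : {fset 'X_{1..n}},
    (forall u, u \in C <-> mdegA L u = b)
    & reduced_homology_dim k (@gcd_complex n C) j = d.

(* The rows of [homog_basis i] form the basis in homological degree i.        *)
Record based_complex (k : fieldType) (n : nat) (L : zmodClosed 'rV[int]_n) :=
  BasedComplex {
    cplx :> graded_complex k L;
    homog_basis : forall i, 'M[{mpoly k[n]}]_(rk cplx i);
    basis_unit : forall i, homog_basis i \in unitmx;
    basis_homog : forall i a, exists c,
      homog_elt (shift cplx i) c (row a (homog_basis i)) }.

Arguments homog_basis {k n L} b i.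

Definition complex_hom (k : fieldType) (n : nat) (L : zmodClosed 'rV[int]_n)
    (F G : graded_complex k L)
    (w : forall i, 'M[{mpoly k[n]}]_(rk F i, rk G i)) : Prop :=
  (forall i, homog_map (shift F i) (shift G i) (w i)) /\
  (forall i, w i.+1 *m diff G i = diff F i *m w i).

Definition based_hom (k : fieldType) (n : nat) (L : zmodClosed 'rV[int]_n)
    (F G : based_complex k L)
    (w : forall i, 'M[{mpoly k[n]}]_(rk F i, rk G i)) : Prop :=
  complex_hom w /\
  forall i (a : 'I_(rk F i)), exists h : 'I_(rk G i), exists2 c : k,
    c != 0 & row a (homog_basis F i) *m w i = c%:MP *: row h (homog_basis G i).

(* In homological degree 0 both modules are R, so that w 0 is the identity    *)
(* when its only entry is 1; likewise C_0 = {1} for the basis of G.           *)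
Definition strongly_indispensable (k : fieldType) (n : nat)
    (L : zmodClosed 'rV[int]_n) (I : {mpoly k[n]} -> Prop)
    (F : based_complex k L) : Prop :=
  starts_at_R F /\
  forall G : based_complex k L,
    minimal_free_resolution I G ->
    (forall a b, homog_basis G 0%N a b = 1) ->
    exists w : forall i, 'M[{mpoly k[n]}]_(rk F i, rk G i),
      [/\ based_hom w,
          (forall i, injective
             (fun v : 'rV[{mpoly k[n]}]_(rk F i) => v *m w i))
        & (forall a b, w 0%N a b = 1)].

(* Main.v *)
(** Koszul homology identifies Tor_(i+1)(R/I_L, k)_b with the reduced homology of
    the divisor complex Delta_b, whose faces are the F such that x^F divides some
    monomial of degree b; by Dowker duality this is the homology of the
    gcd-complex.  If Delta_c = Delta_(c+e) with e <> 0 then Delta_c is a cone, so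
    Dickson's lemma leaves finitely many Betti degrees, and a finite minimal free
    resolution (G, theta) exists.

    Let w embed F in G with w(E) = c H, and suppose that another generator H'' of
    G_(i+1) satisfies deg H = deg H'' + deg x^u.  Compare w with the embedding w'
    obtained after replacing H by H + x^u H'' in the basis of G.  A difference
    w(E') - w'(E') killed by theta lies in m G, so w and w' agree in homological
    degrees at most i by induction; in degree i+1 this forces w'(E) = c (H + x^u H'')
    and theta(x^u H'') = 0, whence H'' lies in ker theta, contained in m G, a
    contradiction.  Hence exactly one generator of G_(i+1) has degree <= b. *)

(* The comparison of Tor with the homology of Delta_b does two jobs. A Betti degree may be witnessed
   by any free resolution, so the comparison has to make the dimension of Tor independent of the
   resolution. It also has to be available before any resolution exists: if a partial resolution
   with cycle module Z_N is exact below N, a zigzag gives H_N(Delta_b) = (Z_N :&: m G_N)_b / (m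
   Z_N)_b. Where this vanishes, a cycle of degree b without constant terms lies in m Z_N, so degree
   b contributes no new generator. This yields finite generation at each stage, and G_i = 0 for i >
   n because Delta_b has at most n vertices.

   Homology is handled through dimensions of subspaces of finite-dimensional spaces, so connecting
   isomorphisms become additive equations between natural numbers.

   In the change of basis everything is read off constant coefficients: two nonzero scalar multiples
   of basis vectors that agree modulo m are equal, which turns a congruence between the two
   embeddings into an identity. *)
Require Import Defs.
From Stdlib Require Import Classical ClassicalEpsilon FunctionalExtensionality.
From HB Require Import structures.
From mathcomp Require Import all_boot all_order all_algebra finmap mpoly.
From mathcomp Require Import zify.
Set Implicit Arguments.
Unset Strict Implicit.
Unset Printing Implicit Defensive.
Import GRing.Theory.
Local Open Scope ring_scope.

(** * Double complexes with exact rows and columns *)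

Section DoubleComplex.
Variable k : fieldType.

(* The connecting isomorphism [H_(j+1)(B / A) = H_j(A)] of an acyclic [B], as an
   equality of dimensions; here [A = ker f] and [B / A] is the image of [f]. *)
Lemma dim_image_exact (V W : vectType k) (f : 'Hom(V, W)) (D : 'End(V))
    (D' : 'End(W)) (B0 B1 B2 : {vspace V})
    (fD : forall x, f (D x) = D' (f x))
    (DB : (D @: B1 <= B0)%VS)
    (exB : (B1 :&: lker D = D @: B2)%VS) :
  (\dim ((f @: B1) :&: lker D') + \dim (D @: (B1 :&: lker f)) =
   \dim ((B0 :&: lker f) :&: (D @: B1)) + \dim (D' @: (f @: B2)))%N.
Proof.
(* [X] consists of the lifts of relative cycles: [f] maps it onto the cycles of the quotient, [D]
   onto the boundaries of [B] that lie in [A]. Rank-nullity for both maps on [X], and for each of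
   them on the kernel of the other, gives the equation. *)
pose X := (B1 :&: lker (D' \o f)%VF)%VS.
have XE x : (x \in X) = (x \in B1) && (D' (f x) == 0).
  by rewrite memv_cap memv_ker comp_lfunE.
have fX : (f @: X = (f @: B1) :&: lker D')%VS.
  apply/eqP; rewrite eqEsubv; apply/andP; split; apply/subvP => y.
    case/memv_imgP => x; rewrite XE => /andP[xB /eqP e] ->.
    by rewrite memv_cap memv_img // memv_ker e eqxx.
  rewrite memv_cap memv_ker => /andP[/memv_imgP[x xB ->] e].
  by apply: memv_img; rewrite XE xB.
have DX : (D @: X = (B0 :&: lker f) :&: (D @: B1))%VS.
  apply/eqP; rewrite eqEsubv; apply/andP; split; apply/subvP => y.
    case/memv_imgP => x; rewrite XE => /andP[xB /eqP e] ->.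
    rewrite !memv_cap memv_ker fD e eqxx memv_img // !andbT.
    by apply: (subvP DB); rewrite memv_img.
  rewrite !memv_cap memv_ker => /andP[/andP[_ e] /memv_imgP[x xB ex]].
  by rewrite ex memv_img // XE xB -fD -ex.
have Xf : (X :&: lker f = B1 :&: lker f)%VS.
  apply/vspaceP => x; rewrite !memv_cap !memv_ker comp_lfunE -andbA.
  by case: (f x =P 0) => [->|_]; rewrite ?linear0 ?eqxx ?andbF.
have XD : (X :&: lker D = B1 :&: lker D)%VS.
  apply/vspaceP => x; rewrite !memv_cap !memv_ker comp_lfunE -andbA -fD.
  by case: (D x =P 0) => [->|_]; rewrite ?linear0 ?eqxx ?andbF.
have ef : (D' @: (f @: B2) = f @: (B1 :&: lker D))%VS.
  rewrite exB -!limg_comp; apply/eq_in_limg => x _.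
  by rewrite !comp_lfunE fD.
have := limg_ker_dim f X; have := limg_ker_dim D X.
rewrite fX DX Xf XD ef.
have := limg_ker_dim f (B1 :&: lker D); have := limg_ker_dim D (B1 :&: lker f).
rewrite -!capvA (capvC (lker f) (lker D)); lia.
Qed.

Section Zigzag.
Variables (V : nat -> vectType k) (D' : forall i, 'Hom(V i.+1, V i)).
Variables (D : forall i, 'End(V i)) (P : forall i, nat -> {vspace V i}).
Hypothesis DD' : forall i x, D' i (D i.+1 x) = D i (D' i x).
Hypothesis DP : forall i j, (D i.+1 @: P i.+1 j.+1 <= P i.+1 j)%VS.
Hypothesis exD : forall i j,
  (P i.+1 j.+1 :&: lker (D i.+1) = D i.+1 @: P i.+1 j.+2)%VS.

Definition cycles i : nat -> {vspace V i} :=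
  match i with
  | 0 => P 0
  | i'.+1 => fun j => (P i'.+1 j :&: lker (D' i'))%VS
  end.

(** One connecting isomorphism for each sequence 0 -> [cycles i.+1] -> [P i.+1] -> [cycles i] -> 0
    carries the homology of the edge [P 0] in degree [N.+1] to [cycles N.+1] in degree 0. Sums stand
    on both sides because subtraction in nat is truncated. *)
Lemma dim_zigzag N
    (exD' : forall i j, (i <= N)%N -> (D' i @: P i.+1 j.+1 = cycles i j.+1)%VS) :
  (\dim (P 0 N.+1 :&: lker (D 0)) +
     \dim (D N.+1 @: (P N.+1 1 :&: lker (D' N))) =
   \dim ((P N.+1 0 :&: lker (D' N)) :&: (D N.+1 @: P N.+1 1)) +
     \dim (D 0 @: P 0 N.+2))%N.
Proof.
have step i j : (i <= N)%N ->
   (\dim (cycles i j.+1 :&: lker (D i)) +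
      \dim (D i.+1 @: cycles i.+1 j.+1) =
    \dim (cycles i.+1 j :&: (D i.+1 @: P i.+1 j.+1)) +
      \dim (D i @: cycles i j.+2))%N.
  move=> iN; rewrite -(exD' i j iN) -(exD' i j.+1 iN) /=.
  by apply: dim_image_exact; [exact: DD' | exact: DP | exact: exD].
(* In positive degrees the output of one step is the input of the next. [exD] says nothing in degree
   0, so there the intersection with the boundaries of [P] remains. *)
have cyclesK i j : (cycles i.+1 j.+1 :&: lker (D i.+1) =
    cycles i.+1 j.+1 :&: (D i.+1 @: P i.+1 j.+2))%VS.
  by rewrite /= -exD capvA [(_ :&: P _ _)%VS]capvC capvA capvv.
have main i : (i <= N)%N ->
  (\dim (P 0 N.+1 :&: lker (D 0)) +
     \dim (D i.+1 @: cycles i.+1 (N - i).+1) =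
   \dim (cycles i.+1 (N - i) :&: (D i.+1 @: P i.+1 (N - i).+1)) +
     \dim (D 0 @: P 0 N.+2))%N.
  elim: i => [|i IH] iN; first by rewrite subn0; apply: (step 0%N N).
  have := IH (ltnW iN).
  have eN : (N - i = (N - i.+1).+1)%N by lia.
  rewrite eN -cyclesK; have := step i.+1 (N - i.+1)%N iN; lia.
by have := main N (leqnn N); rewrite subnn.
Qed.
End Zigzag.
End DoubleComplex.

(** * Simplicial chains *)

Section SupportSpace.
Variables (k : fieldType) (I : finType).
Implicit Types (A : pred I) (f : {ffun I -> k^o}).

Definition off_support A f : {ffun I -> k^o} :=
  [ffun i => if A i then 0 else f i].

Fact off_support_linear A : linear (off_support A).
Proof.
move=> a f g; apply/ffunP => i; rewrite !ffunE.
by case: ifP => _; rewrite ?scaler0 ?addr0.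
Qed.
HB.instance Definition _ A :=
  GRing.isLinear.Build k {ffun I -> k^o} {ffun I -> k^o} _ (off_support A)
    (off_support_linear A).

Definition suppv A : {vspace {ffun I -> k^o}} := lker (linfun (off_support A)).

Lemma suppvP A f : reflect (forall i, ~~ A i -> f i = 0) (f \in suppv A).
Proof.
rewrite memv_ker lfunE /=; apply: (iffP eqP) => [/ffunP e i Ai | e].
  by have := e i; rewrite !ffunE (negPf Ai).
by apply/ffunP => i; rewrite !ffunE; case: ifP => // /negbT /e.
Qed.

Lemma suppvPn A f i : f \in suppv A -> f i != 0 -> A i.
Proof. by move=> /suppvP fA; apply: contraNT => /fA ->. Qed.

Lemma eq_suppv A B : A =1 B -> suppv A = suppv B.
Proof.
by move=> e; apply/vspaceP => f; apply/suppvP/suppvP => h i;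
  have := h i; rewrite e.
Qed.
End SupportSpace.

Section Boundary.
Variables (k : fieldType) (U X : finType).
Implicit Types (f : {ffun {set U} * X -> k^o}) (F T : {set U}).

Definition bsign (v : U) (T : {set U}) : k :=
  (-1) ^+ #|[set w in T | (enum_rank w < enum_rank v)%N]|.

Lemma bsignU1 (u v : U) T : u \notin T ->
  bsign v (u |: T) = (-1) ^+ (enum_rank u < enum_rank v)%N * bsign v T.
Proof.
move=> uT; rewrite /bsign -exprD; congr (_ ^+ _).
case: ltnP => uv.
  have -> : [set w in u |: T | (enum_rank w < enum_rank v)%N] =
      u |: [set w in T | (enum_rank w < enum_rank v)%N].
    by apply/setP => w; rewrite !inE; case: eqP => [->|//]; rewrite uv.
  by rewrite cardsU1 inE (negPf uT) .
suff -> : [set w in u |: T | (enum_rank w < enum_rank v)%N] =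
    [set w in T | (enum_rank w < enum_rank v)%N] by [].
apply/setP => w; rewrite !inE.
by case: (w =P u) => [->|_] /=; rewrite ?ltnNge ?uv ?andbF.
Qed.

Lemma bsignU1_id v T : bsign v (v |: T) = bsign v T.
Proof.
rewrite /bsign.
suff -> : [set w in v |: T | (enum_rank w < enum_rank v)%N] =
    [set w in T | (enum_rank w < enum_rank v)%N] by [].
apply/setP => w; rewrite !inE; by case: (w =P v) => [->|_] /=; rewrite ?ltnn ?andbF.
Qed.

Lemma bsign_sqr v T : bsign v T * bsign v T = 1.
Proof. by rewrite /bsign -expr2 sqrr_sign. Qed.

Lemma ltn_rankN (u v : U) : u != v ->
  (enum_rank u < enum_rank v)%N = ~~ (enum_rank v < enum_rank u)%N.
Proof.
move=> uv; rewrite -leqNgt ltn_neqAle.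
by rewrite (inj_eq val_inj) (inj_eq enum_rank_inj) uv.
Qed.

(* Chains are functions on all vertex sets times a parameter type; a complex and
   a dimension are imposed through supports, see [suppv] and [layer]. *)
Definition bdry f : {ffun {set U} * X -> k^o} :=
  [ffun p : {set U} * X =>
     \sum_(v | v \notin p.1) bsign v p.1 * f (v |: p.1, p.2)].

Fact bdry_linear : linear bdry.
Proof.
move=> a f g; apply/ffunP => p; rewrite !ffunE scaler_sumr -big_split /=.
by apply: eq_bigr => v _; rewrite !ffunE mulrDr /GRing.scale /= mulrCA.
Qed.
HB.instance Definition _ :=
  GRing.isLinear.Build k {ffun {set U} * X -> k^o} {ffun {set U} * X -> k^o}
    _ bdry bdry_linear.

Lemma bdry_bdry f : bdry (bdry f) = 0.
Proof.
apply/ffunP => -[T x]; rewrite !ffunE /=.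
pose G v u := bsign v T * ((-1) ^+ (enum_rank v < enum_rank u)%N * bsign u T)
   * f (u |: (v |: T), x).
have -> : \sum_(v | v \notin T) bsign v T * bdry f (v |: T, x) =
   \sum_(v | v \notin T) \sum_(u | (u != v) && (u \notin T)) G v u.
  apply: eq_bigr => v vT; rewrite ffunE /= mulr_sumr.
  apply: eq_big => [u|u]; rewrite !inE negb_or // => /andP[uv uT].
  by rewrite bsignU1 // /G mulrA.
pose A := \sum_(v | v \notin T) \sum_(u | (u != v) && (u \notin T) &&
  (enum_rank v < enum_rank u)%N) G v u.
pose B := \sum_(v | v \notin T) \sum_(u | (u != v) && (u \notin T) &&
  ~~ (enum_rank v < enum_rank u)%N) G v u.
have -> : \sum_(v | v \notin T) \sum_(u | (u != v) && (u \notin T)) G v u = A + B.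
  rewrite -big_split /=; apply: eq_bigr => v _.
  by rewrite (bigID (fun u => (enum_rank v < enum_rank u)%N)).
suff -> : B = - A by rewrite subrr.
(* Exchanging the sums matches the pair (v, u) with (u, v); exactly one of the two rank comparisons
   contributes a sign. *)
rewrite /B (exchange_big_dep (fun u => u \notin T)) /=; last first.
  by move=> u v _ /andP[/andP[]].
rewrite -sumrN; apply: eq_bigr => v vT; rewrite -sumrN.
apply: eq_big => [u|u].
  rewrite vT andbT eq_sym; case: (boolP (u == v)) => [/eqP ->|uv] /=.
    by rewrite andbF.
  by rewrite (ltn_rankN uv) negbK andbC.
rewrite /G => /andP[uT /andP[/andP[uv _] /negPf e]]; rewrite e.
have -> : (enum_rank v < enum_rank u)%N by rewrite (ltn_rankN uv) e.
by rewrite /= expr0 mul1r expr1 mulN1r mulrN mulNr opprK setUCA [bsign u T * _]mulrC.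
Qed.

Section Cone.
Variable c : X -> option U.

(** The apex may vary with the parameter, on which the boundary does not act. *)
Definition cone f : {ffun {set U} * X -> k^o} :=
  [ffun p : {set U} * X => (if c p.2 is Some v then
     if v \in p.1 then bsign v p.1 * f (p.1 :\ v, p.2) else 0 else 0) : k^o].

(** The cone is a contracting homotopy over every parameter that has an apex: the term f comes from
    adding or removing the apex, and the terms that add another vertex cancel in pairs. *)
Lemma bdry_cone f F x v : c x = Some v ->
  bdry (cone f) (F, x) + cone (bdry f) (F, x) = f (F, x).
Proof.
move=> cx; rewrite !ffunE /= cx.
case: ifP => [vF|/negbT vF]; last first.
  rewrite (bigD1 v) //= ffunE /= cx setU11 setU1K // mulrA.
  rewrite bsignU1_id bsign_sqr mul1r addr0 big1 ?addr0 // => u /andP[uF uv].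
  by rewrite ffunE /= cx !inE eq_sym (negPf uv) (negPf vF) mulr0.
rewrite ffunE /= [X in _ + _ * X](bigD1 v) ?inE ?eqxx //=.
have eF : v |: F :\ v = F by rewrite setD1K.
rewrite eF mulrDr mulrA.
have -> : bsign v (F :\ v) = bsign v F.
  by rewrite -[in RHS]eF bsignU1_id.
rewrite bsign_sqr mul1r addrCA -[RHS]addr0; congr (_ + _).
rewrite mulr_sumr.
have -> : \sum_(u | (u \notin F :\ v) && (u != v))
    bsign v F * (bsign u (F :\ v) * f (u |: F :\ v, x)) =
   \sum_(u | u \notin F)
    bsign v F * (bsign u (F :\ v) * f (u |: F :\ v, x)).
  apply: eq_bigl => u; rewrite !inE negb_and negbK.
  by case: eqP => [->|_] /=; rewrite ?vF ?andbT.
rewrite -big_split big1 //= => u uF.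
have uv : u != v by apply: contraNneq uF => ->.
rewrite ffunE /= cx !inE vF orbT bsignU1 //.
have -> : (u |: F) :\ v = u |: F :\ v.
  apply/setP => w; rewrite !inE; case: eqP => [->|_] /=; last by [].
  by rewrite eq_sym (negPf uv).
have -> : bsign u F = (-1) ^+ (enum_rank v < enum_rank u)%N * bsign u (F :\ v).
  by rewrite -{1}eF bsignU1 // !inE eqxx.
rewrite (ltn_rankN uv); case: (_ < _)%N => /=;
  rewrite ?expr0 ?expr1 ?mul1r ?mulN1r !mulrA -mulrDl;
  by rewrite ?mulNr [bsign v F * _]mulrC ?mulrN ?addNr ?subrr ?mul0r.
Qed.
End Cone.

Definition layer (K : pred ({set U} * X)) (j : nat) : pred ({set U} * X) :=
  fun p => (#|p.1| == j) && K p.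

Definition down_closed (K : pred ({set U} * X)) :=
  forall F v x, K (v |: F, x) -> K (F, x).

Lemma bdry_layer (K : pred ({set U} * X)) j : down_closed K ->
  (linfun bdry @: suppv k (layer K j.+1) <= suppv k (layer K j))%VS.
Proof.
move=> Kd; apply/subvP => _ /memv_imgP[f fK ->]; rewrite lfunE /=.
apply/suppvP => -[T x] /=; rewrite ffunE /= => nK.
apply: big1 => v vT; rewrite (suppvP _ _ fK) ?mulr0 //.
apply: contraNN nK => /andP[/= e Kv]; rewrite /layer /= (Kd _ _ _ Kv) andbT.
by move: e; rewrite cardsU1 vT.
Qed.

(** Coning fills a cycle over each parameter with an apex; over the other parameters there is no
    face of cardinality [j], and the cycle is zero. *)
Lemma bdry_exact (K : pred ({set U} * X)) j : down_closed K ->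
  (exists c : X -> option U, forall F x, layer K j (F, x) ->
     exists2 v, c x = Some v & K (v |: F, x)) ->
  (suppv k (layer K j) :&: lker (linfun bdry) =
   linfun bdry @: suppv k (layer K j.+1))%VS.
Proof.
move=> Kd [c cK]; apply/eqP; rewrite eqEsubv; apply/andP; split; last first.
  rewrite subv_cap bdry_layer //=; apply/subvP => _ /memv_imgP[f fK ->].
  by rewrite memv_ker !lfunE /= bdry_bdry.
apply/subvP => f; rewrite memv_cap => /andP[fK].
rewrite memv_ker lfunE /= => /eqP f0.
apply/memv_imgP; exists (cone c f).
  apply/suppvP => -[T x] /= nK; rewrite ffunE /=.
  case cx: (c x) => [v|//]; case: ifP => // vT.
  rewrite (suppvP _ _ fK) ?mulr0 //; apply: contraNN nK => lK.
  have [u] := cK _ _ lK; rewrite cx => -[<-]; rewrite setD1K // => KT.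
  case/andP: lK => /= /eqP <- _; rewrite /layer /= KT andbT.
  by rewrite [#|T|](cardsD1 v) vT.
rewrite lfunE /=; apply/ffunP => -[F x].
case cx: (c x) => [v|].
  have := bdry_cone f F cx; rewrite f0 => <-.
  suff -> : cone c 0 (F, x) = 0 by rewrite addr0.
  by rewrite ffunE /= cx ffunE mulr0; case: ifP.
rewrite ffunE /= big1 => [|v vF]; last by rewrite ffunE /= cx mulr0.
apply: (suppvP _ _ fK); apply/negP => /cK[v].
by rewrite cx.
Qed.
End Boundary.

(** * From ranks of boundary matrices to dimensions of spaces of chains *)

Section MatrixImage.
Variable k : fieldType.

Lemma dim_limg_mulmxr m n (B : 'M[k]_(m, n)) :
  \dim (limg (linfun (mulmxr B : 'rV_m -> 'rV_n))) = \rank B.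
Proof.
pose X := [tuple row i (row_base B) | i < \rank B].
have XE (i : 'I_(\rank B)) : X`_i = row i (row_base B).
  by rewrite -tnth_nth tnth_mktuple.
have comb (c : 'rV_(\rank B)) : c *m row_base B = \sum_i c 0 i *: X`_i.
  by rewrite mulmx_sum_row; apply: eq_bigr => i _; rewrite XE.
suff /eqP <- : <<X>>%VS == limg (linfun (mulmxr B : 'rV_m -> 'rV_n)).
  have /eqP -> : \dim <<X>> == size X; last by rewrite size_tuple.
  rewrite -/(free X); apply/freeP => c c0 i.
  have : \row_i c i *m row_base B = 0.
    by rewrite comb -[RHS]c0; apply: eq_bigr => j _; rewrite mxE.
  move/eqP; rewrite mulmx_free_eq0 ?row_base_free // => /eqP/rowP/(_ i).
  by rewrite !mxE.
rewrite eqEsubv; apply/andP; split.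
  apply/span_subvP => _ /mapP[i _ ->].
  have : (row i (row_base B) <= B)%MS by rewrite -(eq_row_base B) row_sub.
  by case/submxP => c ->; apply/memv_imgP; exists c; rewrite ?memvf ?lfunE.
apply/subvP => _ /memv_imgP[r _ ->]; rewrite lfunE /=.
have : (r *m B <= row_base B)%MS by rewrite eq_row_base submxMl.
case/submxP => c ->; rewrite comb; apply: memv_suml => i _.
by apply/memvZ/memv_span/mem_nth; rewrite size_tuple.
Qed.

Lemma dim_img_mx (V W : vectType k) (f : 'Hom(V, W)) m n (B : 'M[k]_(m, n))
    (phi : 'Hom('rV[k]_m, V)) (psi : 'Hom('rV[k]_n, W)) :
  injective psi -> (forall r, f (phi r) = psi (r *m B)) ->
  \dim (f @: limg phi) = \rank B.
Proof.
move=> psi_inj comm.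
have /eqP k0 : lker psi == 0%VS by apply/lker0P.
rewrite -limg_comp (_ : (f \o phi)%VF = (psi \o linfun (mulmxr B))%VF).
  by rewrite limg_comp limg_dim_eq ?dim_limg_mulmxr // k0 capv0.
by apply/lfunP => r; rewrite !comp_lfunE lfunE /= comm.
Qed.
End MatrixImage.

Section Chains.
Variables (k : fieldType) (U X : finType) (x0 : X) (K : pred {set U}).
Hypothesis Kdown : forall v T, K (v |: T) -> K T.

(** An ordinary complex, concentrated at the single parameter [x0]. *)
Definition complex_at : pred ({set U} * X) := fun p => (p.2 == x0) && K p.1.

Definition chain s (r : 'rV[k]_#|faces K s|) : {ffun {set U} * X -> k^o} :=
  [ffun p : {set U} * X =>
     \sum_a (if p == (enum_val a, x0) then r 0 a else 0) : k^o].

Fact chain_linear s : linear (@chain s).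
Proof.
move=> c f g; apply/ffunP => p; rewrite !ffunE scaler_sumr -big_split /=.
by apply: eq_bigr => a _; rewrite !mxE; case: ifP; rewrite ?scaler0 ?addr0.
Qed.
HB.instance Definition _ s :=
  GRing.isLinear.Build k 'rV[k]_#|faces K s| {ffun {set U} * X -> k^o}
    _ (@chain s) (@chain_linear s).

Lemma chainE s (r : 'rV[k]_#|faces K s|) a : chain r (enum_val a, x0) = r 0 a.
Proof.
rewrite ffunE (bigD1 a) //= eqxx big1 ?addr0 // => b ba.
by rewrite xpair_eqE eqxx andbT (inj_eq enum_val_inj) eq_sym (negPf ba).
Qed.

Lemma chain_inj s : injective (linfun (@chain s)).
Proof.
by move=> r r'; rewrite !lfunE /= => e; apply/rowP => a; rewrite -!chainE e.
Qed.

Lemma chain_img s :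
  limg (linfun (@chain s)) = suppv k (layer complex_at s).
Proof.
apply/vspaceP => f; apply/memv_imgP/suppvP => [[r _ ->] p np|fK].
  rewrite lfunE /= ffunE big1 // => a _; case: eqP => // e; case/negP: np.
  have := enum_valP a; rewrite inE => /andP[Ka sa].
  by rewrite e /layer /complex_at /= sa eqxx Ka.
exists (\row_a f (enum_val a, x0)); rewrite ?memvf // lfunE /=.
apply/ffunP => p; case: (boolP (layer complex_at s p)) => [lp|/[dup] np /fK ->].
  case: p lp => T x /andP[/= sT /andP[/= /eqP -> KT]].
  have Tf : T \in faces K s by rewrite inE KT.
  rewrite -(enum_rankK_in Tf Tf) chainE mxE //.
rewrite ffunE big1 // => a _; case: eqP => // e; case/negP: np.
have := enum_valP a; rewrite inE => /andP[Ka sa].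
by rewrite e /layer /complex_at /= sa eqxx Ka.
Qed.

Lemma boundary_coefE (A T : {set U}) :
  boundary_coef k A T = \sum_(v | v \notin T) if A == v |: T then bsign k v T else 0.
Proof.
rewrite /boundary_coef -big_mkcondr /=.
apply: eq_big => [v|v /andP[vA /eqP ->]].
  apply/andP/andP => [[vA /eqP ->]|[vT /eqP ->]].
    by rewrite !inE eqxx setD1K.
  by rewrite setU11 setU1K.
by rewrite -bsignU1_id setD1K.
Qed.

Lemma bdry_chain s (r : 'rV[k]_#|faces K s.+1|) :
  bdry (chain r) = chain (r *m boundary_mx k K s).
Proof.
apply/ffunP => -[T x]; rewrite ffunE /=.
have [->|xx] := eqVneq x x0; last first.
  rewrite [RHS]ffunE !big1 // => [a _|v _]; first by rewrite xpair_eqE (negPf xx) andbF.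
  by rewrite ffunE big1 ?mulr0 // => a _; rewrite xpair_eqE (negPf xx) andbF.
have -> : \sum_(v | v \notin T) bsign k v T * chain r (v |: T, x0) =
    \sum_a r 0 a * boundary_coef k (enum_val a) T.
  under eq_bigr => v _ do rewrite ffunE mulr_sumr.
  rewrite exchange_big /=; apply: eq_bigr => a _.
  rewrite boundary_coefE mulr_sumr; apply: eq_bigr => v _.
  rewrite xpair_eqE eqxx andbT eq_sym.
  by case: eqP; rewrite ?mulr0 // mulrC.
case: (boolP (T \in faces K s)) => [Tf|nT].
  rewrite -{2}(enum_rankK_in Tf Tf) chainE mxE.
  by apply: eq_bigr => a _; rewrite mxE enum_rankK_in.
rewrite [RHS]ffunE [RHS]big1 => [|a _]; last first.
  rewrite xpair_eqE eqxx andbT; case: eqP => // e.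
  by rewrite e enum_valP in nT.
rewrite big1 // => a _; rewrite boundary_coefE big1 ?mulr0 // => v vT.
case: eqP => // e; case/negP: nT; have := enum_valP a; rewrite e !inE.
by rewrite cardsU1 vT => /andP[/Kdown -> ].
Qed.

Lemma complex_at_down : down_closed complex_at.
Proof. by move=> F v x /andP[/= ex /Kdown KF]; apply/andP. Qed.

(** The parameter type is arbitrary, so the complex can be placed on an edge of a double complex. *)
Lemma reduced_homology_dimE j :
  reduced_homology_dim k K j =
  (\dim (suppv k (layer complex_at j.+1) :&: lker (linfun (@bdry k U X))) -
   \dim (linfun (@bdry k U X) @: suppv k (layer complex_at j.+2)))%N.
Proof.
have dimB s : \dim (linfun (@bdry k U X) @: suppv k (layer complex_at s.+1)) =
    \rank (boundary_mx k K s).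
  rewrite -chain_img; apply: dim_img_mx (@chain_inj s) _ => r.
  by rewrite !lfunE /= bdry_chain.
rewrite /reduced_homology_dim mxrank_ker -!dimB; congr (_ - _)%N.
have /eqP k0 : lker (linfun (@chain j.+1)) == 0%VS by apply/lker0P/chain_inj.
have <- : \dim (suppv k (layer complex_at j.+1)) = #|faces K j.+1|.
  rewrite -chain_img limg_dim_eq ?k0 ?capv0 // dimvf; apply: mul1n.
by rewrite -(limg_ker_dim (linfun (@bdry k U X))
  (suppv k (layer complex_at j.+1))) addnK.
Qed.
End Chains.

Section Swap.
Variables (k : fieldType) (I J : finType).

Definition swapf (f : {ffun I * J -> k^o}) : {ffun J * I -> k^o} :=
  [ffun p : J * I => f (p.2, p.1)].

Fact swapf_linear : linear swapf.
Proof. by move=> a f g; apply/ffunP => p; rewrite !ffunE. Qed.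
HB.instance Definition _ :=
  GRing.isLinear.Build k {ffun I * J -> k^o} {ffun J * I -> k^o} _ swapf
    swapf_linear.
End Swap.

Lemma swapfK (k : fieldType) (I J : finType) :
  cancel (@swapf k I J) (@swapf k J I).
Proof. by move=> f; apply/ffunP => -[i j]; rewrite !ffunE. Qed.

Lemma swapf_suppv (k : fieldType) (I J : finType) (A : pred (I * J)) f :
  (swapf f \in suppv k (fun p : J * I => A (p.2, p.1))) = (f \in suppv k A).
Proof.
apply/suppvP/suppvP => h [i j] Ap; last by rewrite ffunE h.
by have := h (j, i) Ap; rewrite ffunE.
Qed.

Lemma bdry_layer0 (k : fieldType) (U X : finType) (K : pred ({set U} * X)) :
  (suppv k (layer K 0) <= lker (linfun (@bdry k U X)))%VS.
Proof.
apply/subvP => f /suppvP fK; rewrite memv_ker lfunE /=; apply/eqP/ffunP => -[F x].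
rewrite !ffunE big1 // => v vF; rewrite fK ?mulr0 //= /layer /= cardsU1.
by rewrite (negPf vF : v \in F = false).
Qed.

(** The boundary vanishes on chains of the empty face, so exactness there is surjectivity. *)
Lemma bdry_onto (k : fieldType) (U X : finType) (K : pred ({set U} * X)) :
  down_closed K ->
  (exists c : X -> option U, forall F x, layer K 0 (F, x) ->
     exists2 v, c x = Some v & K (v |: F, x)) ->
  (linfun (@bdry k U X) @: suppv k (layer K 1) = suppv k (layer K 0))%VS.
Proof.
by move=> Kd Kc; rewrite -bdry_exact //; apply/capv_idPl/bdry_layer0.
Qed.

(** * Dowker duality *)

Section Dowker.
Variables (k : fieldType) (U W : finType) (R : U -> W -> bool).

Definition common_right : pred {set U} :=
  fun F => (F == set0) || [exists w, [forall u in F, R u w]].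
Definition common_left : pred {set W} :=
  fun T => (T == set0) || [exists u, [forall w in T, R u w]].

(** The last two conditions act on the edges: for [T] empty the first one is vacuous, and the pairs
    (F, set0) are to be the faces of [common_right]; likewise for [F] empty. *)
Definition related (F : {set U}) (T : {set W}) :=
  [&& [forall u in F, forall w in T, R u w], common_right F & common_left T].

Lemma common_right_down v F : common_right (v |: F) -> common_right F.
Proof.
case/orP => [/eqP/setP/(_ v)|/existsP[w /forall_inP h]]; first by rewrite setU11 inE.
apply/orP; right; apply/existsP; exists w; apply/forall_inP => u uF.
by apply: h; rewrite inE uF orbT.
Qed.

Lemma common_left_down v T : common_left (v |: T) -> common_left T.
Proof.
case/orP => [/eqP/setP/(_ v)|/existsP[w /forall_inP h]]; first by rewrite setU11 inE.
apply/orP; right; apply/existsP; exists w; apply/forall_inP => u uF.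
by apply: h; rewrite inE uF orbT.
Qed.

Lemma relatedP (F : {set U}) (T : {set W}) :
  reflect ((forall u w, u \in F -> w \in T -> R u w) /\
           common_right F /\ common_left T) (related F T).
Proof.
apply: (iffP and3P) => [[/forall_inP h a b]|[h [a b]]]; split=> //.
  by move=> u w uF wT; have /forall_inP := h _ uF; apply.
by apply/forall_inP => u uF; apply/forall_inP => w; apply: h.
Qed.

Definition bdry_right (f : {ffun {set U} * {set W} -> k^o}) :=
  swapf (bdry (swapf f)).

Fact bdry_right_linear : linear bdry_right.
Proof. by move=> a f g; rewrite /bdry_right !linearP. Qed.
HB.instance Definition _ :=
  GRing.isLinear.Build k {ffun {set U} * {set W} -> k^o}
    {ffun {set U} * {set W} -> k^o} _ bdry_right bdry_right_linear.

Lemma bdry_rightC f : bdry (bdry_right f) = bdry_right (bdry f).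
Proof.
apply/ffunP => -[F T]; rewrite !ffunE /=.
transitivity (\sum_(v | v \notin F) \sum_(w | w \notin T)
  bsign k v F * (bsign k w T * f (v |: F, w |: T))).
  apply: eq_bigr => v _; rewrite !ffunE /= mulr_sumr.
  by apply: eq_bigr => w _; rewrite !ffunE.
rewrite exchange_big; apply: eq_bigr => w _.
rewrite !ffunE /= mulr_sumr; apply: eq_bigr => v _.
by rewrite mulrCA.
Qed.

(* [P i j] is spanned by the pairs (F, T) with #|F| = i, #|T| = j and F x T
   contained in R; its edges are the chains of the two complexes. *)
Let D' := linfun (@bdry k U {set W}).
Let D := linfun bdry_right.
Let P (i j : nat) := suppv k (fun p : {set U} * {set W} =>
  [&& #|p.1| == i, #|p.2| == j & related p.1 p.2]).

Let col (j : nat) : pred ({set U} * {set W}) :=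
  fun p => (#|p.2| == j) && related p.1 p.2.
Let row (i : nat) : pred ({set W} * {set U}) :=
  fun p => (#|p.2| == i) && related p.2 p.1.

Let Pcol i j : P i j = suppv k (layer (col j) i).
Proof. exact: eq_suppv. Qed.

Let Prow i j f : (f \in P i j) = (swapf f \in suppv k (layer (row i) j)).
Proof.
rewrite -[LHS]swapf_suppv (@eq_suppv _ _ _ (layer (row i) j)) // => -[T F].
by rewrite /layer /row /= andbCA.
Qed.

Let col_down j : down_closed (col j).
Proof.
move=> F v T /andP[/= cT /relatedP[h [a b]]]; rewrite /col /= cT.
apply/relatedP; split; last first.
  by split=> //; apply: common_right_down a.
by move=> u w uF; apply: h; rewrite inE uF orbT.
Qed.

Let row_down i : down_closed (row i).
Proof.
move=> T w F /andP[/= cF /relatedP[h [a b]]]; rewrite /row /= cF.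
apply/relatedP; split; last first.
  by split=> //; apply: common_left_down b.
by move=> u v uF vT; apply: h; rewrite // inE vT orbT.
Qed.

(** For fixed nonempty [T] the sets [F] form the full simplex on the vertices related to all of [T];
    [common_left] supplies one. The apex must depend on [T] alone, hence the choice by [pick]. *)
Let col_cone i j : exists c : {set W} -> option U, forall F T,
  layer (col j.+1) i (F, T) -> exists2 v, c T = Some v & col j.+1 (v |: F, T).
Proof.
exists (fun T : {set W} => [pick u | [forall w in T, R u w]]) => F T.
case/andP=> _ /andP[/= cT /relatedP[h [a b]]].
have T0 : (T == set0) = false by rewrite -cards_eq0 (eqP cT).
move: (b); rewrite /common_left T0 /= => /existsP[u0 u0T].
case: pickP => [v /forall_inP vT|/(_ u0)]; last by rewrite u0T.
exists v => //; rewrite /col /= cT /=; apply/relatedP.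
have h' : forall u w, u \in v |: F -> w \in T -> R u w.
  by move=> u w /setU1P[->|]; [exact: vT | exact: h].
split=> //; split=> //; apply/orP; right.
have /set0Pn[w wT] : T != set0 by rewrite T0.
by apply/existsP; exists w; apply/forall_inP => u uF; apply: h'.
Qed.

Let row_cone i j : exists c : {set U} -> option W, forall T F,
  layer (row i.+1) j (T, F) -> exists2 v, c F = Some v & row i.+1 (v |: T, F).
Proof.
exists (fun F : {set U} => [pick w | [forall u in F, R u w]]) => T F.
case/andP=> _ /andP[/= cF /relatedP[h [a b]]].
have F0 : (F == set0) = false by rewrite -cards_eq0 (eqP cF).
move: (a); rewrite /common_right F0 /= => /existsP[w0 w0F].
case: pickP => [v /forall_inP vF|/(_ w0)]; last by rewrite w0F.
exists v => //; rewrite /row /= cF /=; apply/relatedP.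
have h' : forall u w, u \in F -> w \in v |: T -> R u w.
  by move=> u w uF /setU1P[->|]; [exact: vF | exact: h].
split=> //; split=> //; apply/orP; right.
have /set0Pn[u uF] : F != set0 by rewrite F0.
by apply/existsP; exists u; apply/forall_inP => w; apply: h'.
Qed.

Let img_row i j g : (g \in D @: P i j)%VS =
  (swapf g \in linfun (@bdry k W {set U}) @: suppv k (layer (row i) j))%VS.
Proof.
apply/memv_imgP/memv_imgP => [[f fP ->]|[f fP e]].
  by exists (swapf f); rewrite -?Prow // !lfunE /= swapfK.
exists (swapf f); first by rewrite Prow swapfK.
by move: e; rewrite !lfunE /= /bdry_right swapfK => <-; rewrite swapfK.
Qed.

Let ker_row g : (g \in lker D) = (swapf g \in lker (linfun (@bdry k W {set U}))).
Proof.
rewrite !memv_ker !lfunE /= /bdry_right.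
by rewrite -(inj_eq (can_inj (@swapfK k _ _))) linear0 swapfK.
Qed.

Let exD i j : (P i.+1 j.+1 :&: lker D = D @: P i.+1 j.+2)%VS.
Proof.
apply/vspaceP => f; rewrite img_row -(bdry_exact k (@row_down i.+1) (row_cone i j.+1)).
by rewrite !memv_cap -Prow -ker_row.
Qed.

Let ontoD i : (D @: P i.+1 1 = P i.+1 0)%VS.
Proof.
apply/vspaceP => f.
by rewrite img_row (bdry_onto k (@row_down i.+1) (row_cone i 0)) -Prow.
Qed.

Let exD' i j : (P i j.+1 :&: lker D' = D' @: P i.+1 j.+1)%VS.
Proof. by rewrite !Pcol -(bdry_exact k (@col_down j.+1) (col_cone i j)). Qed.

Let ontoD' j : (D' @: P 1 j.+1 = P 0 j.+1)%VS.
Proof. by rewrite !Pcol -(bdry_onto k (@col_down j.+1) (col_cone 0 j)). Qed.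

Let PE_right i : P i 0 = suppv k (layer (complex_at set0 common_right) i).
Proof.
apply: eq_suppv => -[F T]; rewrite /layer /complex_at /= cards_eq0.
case: (_ == i) => //=; case: eqP => //= ->.
apply/relatedP/idP => [[_ []] //|h]; split; first by move=> u w; rewrite inE.
by split=> //; apply/orP; left.
Qed.

Let PE_left j f : (f \in P 0 j) =
  (swapf f \in suppv k (layer (complex_at set0 common_left) j)).
Proof.
rewrite Prow (@eq_suppv _ _ _ (layer (complex_at set0 common_left) j)) // => -[T F].
rewrite /layer /complex_at /row /= cards_eq0.
case: (_ == j) => //=; case: eqP => //= ->.
apply/relatedP/idP => [[_ []] //|h]; split; first by move=> u w; rewrite inE.
by split=> //; apply/orP; left.
Qed.

Let dim_swap (S : {vspace {ffun {set U} * {set W} -> k^o}})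
    (S' : {vspace {ffun {set W} * {set U} -> k^o}}) :
  (forall f, (f \in S) = (swapf f \in S')) -> \dim S = \dim S'.
Proof.
move=> SS'; pose s := linfun (@swapf k {set U} {set W}).
have /eqP k0 : lker s == 0%VS.
  by apply/lker0P => f g; rewrite !lfunE; apply: (can_inj (@swapfK k _ _)).
rewrite -(limg_dim_eq (f := s)) ?k0 ?capv0 //; congr (\dim _); apply/vspaceP => g.
apply/memv_imgP/idP => [[f fS ->]|gS]; first by rewrite lfunE -SS'.
by exists (swapf g); rewrite ?lfunE ?SS' /= ?swapfK.
Qed.

(** Off the edges all rows and columns are cones, so the zigzag joins the homology of the edge of
    the sets [T] to that of the edge of the sets [F]. *)
Lemma dowker N :
  reduced_homology_dim k common_left N = reduced_homology_dim k common_right N.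
Proof.
have DD' x : D' (D x) = D (D' x) by rewrite !lfunE /= bdry_rightC.
have DP i j : (D @: P i.+1 j.+1 <= P i.+1 j)%VS.
  case: j => [|j]; first by rewrite ontoD.
  by rewrite -exD capvSl.
pose V (_ : nat) : vectType k := {ffun {set U} * {set W} -> k^o}.
have := @dim_zigzag k V (fun=> D') (fun=> D) P (fun=> DD') DP exD N.
have exC i j : (i <= N)%N -> (D' @: P i.+1 j.+1)%VS =
   @cycles k V (fun=> D') P i j.+1.
  by case: i => [|i] _ /=; [exact: ontoD' | rewrite -exD'].
(* The end of the zigzag becomes the other edge: [D] maps [P N.+1 1] onto [P N.+1 0], and D (D' (P
   N.+2 1)) = D' (D (P N.+2 1)) is the space of boundaries in [P N.+1 0]. *)
move/(_ exC); rewrite ontoD exD' -limg_comp.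
have -> : (D \o D' = D' \o D)%VF by apply/lfunP => x; rewrite !comp_lfunE.
rewrite limg_comp ontoD.
have -> : (P N.+1 0 :&: lker D' :&: P N.+1 0 = P N.+1 0 :&: lker D')%VS.
  by rewrite capvC capvA capvv.
rewrite (reduced_homology_dimE k (set0 : {set U}) common_left_down).
rewrite (reduced_homology_dimE k (set0 : {set W}) common_right_down).
rewrite -!PE_right -/D'.
have -> : \dim (suppv k (layer (complex_at (set0 : {set U}) common_left) N.+1)
    :&: lker (linfun (@bdry k W {set U}))) = \dim (P 0 N.+1 :&: lker D).
  by apply/esym/dim_swap => f; rewrite !memv_cap -PE_left -ker_row.
have -> : \dim (linfun (@bdry k W {set U}) @:
    suppv k (layer (complex_at (set0 : {set U}) common_left) N.+2)) =
    \dim (D @: P 0 N.+2).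
  have -> : suppv k (layer (complex_at (set0 : {set U}) common_left) N.+2) =
      suppv k (layer (row 0) N.+2).
    by apply/vspaceP => g; rewrite -[g]swapfK -PE_left -Prow.
  by apply/esym/dim_swap => f; rewrite img_row.
have subn_eq (a b c d : nat) : (a + d = c + b -> a - b = c - d)%N by lia.
exact: subn_eq.
Qed.
End Dowker.

(** * Degrees and finiteness of antichains *)

Section Degrees.
Variables (n : nat) (L : zmodClosed 'rV[int]_n).
Local Notation deg := (mdegA L).

Lemma mdegAE u : deg u = \pi_({ideal_quot L})%qT (exponent_vector u).
Proof.
rewrite /mdegA /gen_deg; have -> : exponent_vector u =
    \sum_(i < n) (delta_mx 0 i : 'rV[int]_n) *+ u i.
  apply/rowP => j; rewrite mxE summxE (bigD1 j) //= big1 ?addr0 => [|i ij].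
    by rewrite mulmxnE mxE !eqxx; apply: esym (natz _).
  by rewrite mulmxnE mxE [j == i]eq_sym (negPf ij) andbF mul0rn.
by rewrite raddf_sum; apply: eq_bigr => i _; rewrite raddfMn.
Qed.

Lemma mdegA_eqE u v :
  (deg u == deg v) = (exponent_vector u - exponent_vector v \in L).
Proof. by rewrite !mdegAE; apply/esym/Quotient.idealrBE. Qed.

Lemma mdegA0 : deg 0%MM = 0.
Proof. by rewrite /mdegA big1 // => i _; rewrite mnm0E. Qed.

Lemma mdegAD u v : deg (u + v)%MM = deg u + deg v.
Proof.
rewrite /mdegA -big_split; apply: eq_bigr => i _ /=.
by rewrite mnmDE mulrnDr.
Qed.

Lemma mdegA_antichain u v : pointed_lattice L ->
  deg u = deg v -> (u <= v)%MM -> u = v.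
Proof.
move=> hL /esym/eqP; rewrite mdegA_eqE => vuL /mnm_lepP uv.
have : exponent_vector v - exponent_vector u = 0.
  by apply: hL => // j; rewrite !mxE Num.Theory.subr_ge0 lez_nat.
move/rowP => e; apply/mnmP => j; have := e j; rewrite !mxE => /eqP.
by rewrite subr_eq0 => /eqP[].
Qed.
End Degrees.

(** Induction on the number of coordinates compared. The elements found for [m] coordinates already
    serve every [a] whose next coordinate is large; each of the finitely many small values of that
    coordinate is a case with [m] coordinates. *)
Lemma dickson_below n (m : nat) (A : 'X_{1..n} -> Prop) :
  exists2 s : seq 'X_{1..n}, (forall t, t \in s -> A t) &
    forall a, A a -> exists2 t, t \in s &
      forall l : 'I_n, (l < m)%N -> (t l <= a l)%N.
Proof.
elim: m A => [|m IH] A.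
  have [[a Aa]|nA] := classic (exists a, A a).
    exists [:: a] => [t|b _]; first by rewrite inE => /eqP ->.
    by exists a; rewrite ?inE.
  by exists [::] => // a Aa; case: nA; exists a.
have [s sA sP] := IH A.
case: (ltnP m n) => [mn|nm]; last first.
  exists s => // a /sP[t ts tP]; exists t => // l _; apply: tP.
  exact: leq_trans (ltn_ord l) nm.
(* From [M] on, the coordinate [lm] of [a] bounds that of every element of [s]. *)
pose lm := Ordinal mn; pose M := (\max_(t <- s) t lm)%N.
have [s' s'A s'P] : exists2 s' : seq 'X_{1..n}, (forall t, t \in s' -> A t) &
    forall a, A a -> (a lm < M)%N -> exists2 t, t \in s' &
      forall l : 'I_n, (l < m.+1)%N -> (t l <= a l)%N.
  elim: M => [|e [s' s'A s'P]]; first by exists [::].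
  have [se seA seP] := IH (fun a => A a /\ a lm = e).
  exists (se ++ s') => [t|a Aa].
    by rewrite mem_cat => /orP[/seA[]|/s'A].
  rewrite ltnS leq_eqVlt => /orP[/eqP ae|/(s'P _ Aa)[t ts tP]]; last first.
    by exists t; rewrite // mem_cat ts orbT.
  have [t ts tP] := seP a (conj Aa ae); exists t; first by rewrite mem_cat ts.
  move=> l; rewrite ltnS leq_eqVlt => /orP[/eqP lm'|/tP //].
  have -> : l = lm by apply: val_inj.
  by rewrite ae; case: (seA _ ts) => _ ->.
exists (s ++ s') => [t|a Aa]; first by rewrite mem_cat => /orP[/sA|/s'A].
case: (ltnP (a lm) M) => [/(s'P _ Aa)[t ts tP]|Ma].
  by exists t; rewrite // mem_cat ts orbT.
have [t ts tP] := sP a Aa; exists t; first by rewrite mem_cat ts.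
move=> l; rewrite ltnS leq_eqVlt => /orP[/eqP lm'|/tP //].
have -> : l = lm by apply: val_inj.
by apply: leq_trans Ma; rewrite /M; apply: leq_bigmax_seq.
Qed.

Lemma antichain_finite n (A : 'X_{1..n} -> Prop) :
  (forall u v, A u -> A v -> (u <= v)%MM -> u = v) ->
  exists s : seq 'X_{1..n}, forall u, A u <-> u \in s.
Proof.
move=> anti; have [s sA sP] := dickson_below n A.
exists s => u; split=> [Au|/sA //]; have [t ts tu] := sP u Au.
have <- // : t = u.
by apply: anti; [exact: sA | exact: Au | apply/mnm_lepP => l; apply: tu].
Qed.

Lemma fiber_finite n (L : zmodClosed 'rV[int]_n) (hL : pointed_lattice L) c :
  exists s : seq 'X_{1..n}, forall u, (u \in s) = (mdegA L u == c).
Proof.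
have [u v uc vc uv|s sP] := @antichain_finite n (fun u => mdegA L u = c).
  by apply: (mdegA_antichain hL) uv; rewrite uc.
by exists s => u; apply/idP/eqP => /sP.
Qed.

(** * Homogeneous parts of polynomial vectors *)

Section MonomialFilter.
Variables (k : fieldType) (n : nat).
Implicit Types (A : pred 'X_{1..n}) (p q : {mpoly k[n]}).

Lemma mcoeffMXE p u m :
  (p * 'X_[u])@_m = if (u <= m)%MM then p@_(m - u) else 0.
Proof.
case: ifP => um; first by rewrite -{1}(submK um) addmC mcoeffMX.
apply/eqP; rewrite mcoeff_eq0 (perm_mem (msuppMX p u)).
by apply/mapP => -[m' _ e]; rewrite e lem_addr in um.
Qed.

Definition mfilter A p : {mpoly k[n]} :=
  \sum_(m <- msupp p | A m) p@_m *: 'X_[m].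

Lemma mcoeff_mfilter A p m : (mfilter A p)@_m = if A m then p@_m else 0.
Proof.
rewrite /mfilter raddf_sum /=.
have [mp|] := boolP (m \in msupp p); last first.
  move=> /[dup] mp; rewrite -mcoeff_eq0 => /eqP ->; rewrite if_same big_seq_cond.
  apply: big1 => m' /andP[m'p _]; rewrite mcoeffZ mcoeffX.
  case: eqP => [e|_]; last by rewrite mulr0.
  by rewrite -e m'p in mp.
rewrite big_mkcond (bigD1_seq m) ?msupp_uniq //= big1 ?addr0 => [|m' m'm].
  by rewrite mcoeffZ mcoeffX eqxx mulr1.
by case: ifP; rewrite // mcoeffZ mcoeffX (negPf m'm) mulr0.
Qed.

Fact mfilter_linear A : linear (mfilter A).
Proof.
move=> a p q; apply/mpolyP => m; rewrite !(mcoeff_mfilter, mcoeffD, mcoeffZ).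
by case: ifP; rewrite ?mulr0 ?addr0.
Qed.
HB.instance Definition _ A :=
  GRing.isLinear.Build k {mpoly k[n]} {mpoly k[n]} _ (mfilter A)
    (mfilter_linear A).

Lemma mfilter_msupp A p m : (m \in msupp (mfilter A p)) = A m && (m \in msupp p).
Proof. by rewrite !mcoeff_msupp mcoeff_mfilter; case: ifP; rewrite ?eqxx. Qed.

Lemma mfilter_id A p : (forall m, m \in msupp p -> A m) -> mfilter A p = p.
Proof.
move=> pA; apply/mpolyP => m; rewrite mcoeff_mfilter; case: ifP => // mA.
by apply/esym/eqP; rewrite mcoeff_eq0; apply/negP => /pA; rewrite mA.
Qed.

Lemma mfilterMX A p u :
  mfilter A (p * 'X_[u]) = mfilter (fun m => A (m + u)%MM) p * 'X_[u].
Proof.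
apply/mpolyP => m; rewrite mcoeff_mfilter !mcoeffMXE mcoeff_mfilter.
by case: (boolP (u <= m)%MM) => um; [rewrite submK | rewrite if_same].
Qed.

Lemma mdivX p u : (forall m, m \in msupp p -> (u <= m)%MM) ->
  exists q, p = q * 'X_[u].
Proof.
move=> pu; exists (\sum_(m <- msupp p) p@_m *: 'X_[m - u]).
rewrite {1}[p]mpolyE mulr_suml !big_seq; apply: eq_bigr => m mp.
by rewrite -scalerAl -mpolyXD submK ?pu.
Qed.
End MonomialFilter.

Section HomogeneousParts.
Variables (k : fieldType) (n : nat) (L : zmodClosed 'rV[int]_n).
Implicit Types (p q : {mpoly k[n]}) (c e : lattice_quot L).
Local Notation deg := (mdegA L).

Definition hpart c : {mpoly k[n]} -> {mpoly k[n]} :=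
  mfilter (fun m => deg m == c).
HB.instance Definition _ c :=
  GRing.Linear.copy (hpart c) (mfilter (fun m => deg m == c)).

Lemma hpartMr c e p q : (forall m, m \in msupp q -> deg m = e) ->
  hpart (c + e) (p * q) = hpart c p * q.
Proof.
move=> qe; suff : hpart (c + e) (p * (\sum_(m <- msupp q) q@_m *: 'X_[m])) =
    hpart c p * (\sum_(m <- msupp q) q@_m *: 'X_[m]) by rewrite -mpolyE.
rewrite /hpart mulr_sumr [RHS]mulr_sumr linear_sum !big_seq /=; apply: eq_bigr => m mq.
rewrite -!scalerAr linearZ /= mfilterMX.
suff -> : mfilter (fun m' => deg (m' + m)%MM == c + e) p =
    mfilter (fun m' => deg m' == c) p by [].
apply: eq_bigl => m'; rewrite mdegAD (qe _ mq).
exact: (inj_eq (addIr e)).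
Qed.

Section Vectors.
Variables (r : nat) (d : 'I_r -> lattice_quot L).
Implicit Types v : 'rV[{mpoly k[n]}]_r.

Definition hcomp c v : 'rV[{mpoly k[n]}]_r := \row_a hpart (c - d a) (v 0 a).

Lemma hcompD c v w : hcomp c (v + w) = hcomp c v + hcomp c w.
Proof. by apply/rowP => j; rewrite !mxE /hpart raddfD. Qed.

Lemma hcomp_homog c v : homog_elt d c (hcomp c v).
Proof.
move=> j m; rewrite mxE mfilter_msupp => /andP[/eqP -> _].
by rewrite subrK.
Qed.

Lemma hcomp_id c v : homog_elt d c v -> hcomp c v = v.
Proof.
move=> h; apply/rowP => j; rewrite mxE; apply: mfilter_id => m /h <-.
by rewrite addrK.
Qed.

Lemma hcomp_msupp c v j m : m \in msupp (hcomp c v 0 j) -> m \in msupp (v 0 j).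
Proof. by rewrite mxE mfilter_msupp => /andP[]. Qed.

Lemma hcomp_sum v : exists s : seq (lattice_quot L), v = \sum_(c <- s) hcomp c v.
Proof.
pose degs j := [seq deg m + d j | m <- msupp (v 0 j)].
exists (undup (flatten [seq degs j | j <- enum 'I_r])).
apply/rowP => j; rewrite summxE; apply/mpolyP => m; rewrite raddf_sum /=.
have [mv|] := boolP (m \in msupp (v 0 j)); last first.
  move=> mv; rewrite big1 => [|c _]; last first.
    by apply/eqP; rewrite mcoeff_eq0; apply: contraNN mv; apply: hcomp_msupp.
  by apply/eqP; rewrite mcoeff_eq0.
rewrite (bigD1_seq (deg m + d j)) ?undup_uniq //=; last first.
  rewrite mem_undup; apply/flattenP; exists (degs j).
    by apply/mapP; exists j; rewrite ?mem_enum.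
  exact: (map_f (fun m => deg m + d j)).
rewrite mxE mcoeff_mfilter addrK eqxx big1 ?addr0 // => c ce.
rewrite mxE mcoeff_mfilter; case: eqP => // e.
by rewrite e subrK eqxx in ce.
Qed.

Lemma hcompZX c u v : hcomp c ('X_[u] *: v) = 'X_[u] *: hcomp (c - deg u) v.
Proof.
apply/rowP => j; rewrite !mxE mulrC [RHS]mulrC -(@hpartMr _ (deg u)).
  by rewrite addrAC subrK.
by move=> m; rewrite msuppX inE => /eqP ->.
Qed.
End Vectors.

Lemma hcomp_mulmx r s (d : 'I_r -> lattice_quot L) (d' : 'I_s -> lattice_quot L)
    (M : 'M[{mpoly k[n]}]_(r, s)) c v :
  homog_map d d' M -> hcomp d c v *m M = hcomp d' c (v *m M).
Proof.
move=> hM; apply/rowP => j; rewrite !mxE linear_sum /=.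
apply: eq_bigr => a _; rewrite mxE.
have := @hpartMr (c - d a) (d a - d' j) (v 0 a) (M a j).
rewrite addrA subrK => -> // m mM.
have := hM a j m; rewrite mxE => /(_ mM) <-.
by rewrite addrK.
Qed.

Lemma homog_eltD r (d : 'I_r -> lattice_quot L) c (v w : 'rV[{mpoly k[n]}]_r) :
  homog_elt d c v -> homog_elt d c w -> homog_elt d c (v + w).
Proof.
by move=> /hcomp_id <- /hcomp_id <-; rewrite -hcompD; apply: hcomp_homog.
Qed.
End HomogeneousParts.

(** * Membership in the irrelevant ideal and in the lattice ideal *)

Section IrrelevantIdeal.
Variables (k : fieldType) (n : nat).
Implicit Types p q : {mpoly k[n]}.

Lemma mcoeff0_sum p : p@_0%MM = 0 ->
  exists z : 'I_n -> {mpoly k[n]}, p = \sum_l 'X_l * z l.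
Proof.
(* The nonconstant monomials are partitioned by one chosen variable dividing each of them. *)
move=> p0; pose A l (m : 'X_{1..n}) := [pick l | m l != 0%N] == Some l.
have /fin_all_exists[z zP] l : exists z, mfilter (A l) p = z * 'X_[U_(l)].
  apply: mdivX => m; rewrite mfilter_msupp lep1mP => /andP[/eqP].
  by case: pickP => // l' h [<-].
exists z; apply/mpolyP => m; rewrite raddf_sum /=.
under eq_bigr => l _ do rewrite mulrC -zP mcoeff_mfilter /A.
case: pickP => [l ml|m0].
  rewrite (bigD1 l) //= eqxx big1 ?addr0 // => l' l'l; case: eqP => // -[e].
  by rewrite e eqxx in l'l.
rewrite big1 // -[RHS]p0; congr (_@__); apply/mnmP => l.
by rewrite mnm0E; apply/eqP; rewrite -[_ == _]negbK m0.
Qed.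

Lemma irrelevant_idealP p : irrelevant_ideal p <-> p@_0%MM = 0.
Proof.
split=> [[s sX ->]|/mcoeff0_sum[z ->]].
  rewrite raddf_sum /= big_seq big1 // => q /sX[l ->].
  by rewrite rmorphM /= mcoeffX mnm1_eq0 mulr0.
exists [seq (z l, 'X_l) | l <- enum 'I_n].
  by move=> q /mapP[l _ ->]; exists l.
by rewrite big_map big_enum; apply: eq_bigr => l _; rewrite mulrC.
Qed.
End IrrelevantIdeal.

Lemma ideal_genD (R : comNzRingType) (S : R -> Prop) x y :
  ideal_gen S x -> ideal_gen S y -> ideal_gen S (x + y).
Proof.
move=> [s sS ->] [t tS ->]; exists (s ++ t); last by rewrite big_cat.
by move=> q; rewrite mem_cat => /orP[/sS|/tS].
Qed.

Lemma ideal_genM (R : comNzRingType) (S : R -> Prop) x y :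
  ideal_gen S y -> ideal_gen S (x * y).
Proof.
move=> [s sS ->]; exists [seq (x * q.1, q.2) | q <- s].
  by move=> _ /mapP[q /sS qS ->].
by rewrite big_map mulr_sumr; apply: eq_bigr => q _; rewrite mulrA.
Qed.

Lemma ideal_gen_sum (R : comNzRingType) (S : R -> Prop) (I : eqType) (s : seq I) f :
  (forall i, i \in s -> ideal_gen S (f i)) -> ideal_gen S (\sum_(i <- s) f i).
Proof.
elim: s => [|i s IH] h; first by exists [::]; rewrite ?big_nil.
rewrite big_cons; apply: ideal_genD; first by apply: h; rewrite mem_head.
by apply: IH => j js; apply: h; rewrite inE js orbT.
Qed.

Section LatticeIdeal.
Variables (k : fieldType) (n : nat) (L : zmodClosed 'rV[int]_n).
Implicit Types (p q : {mpoly k[n]}) (c : lattice_quot L).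
Local Notation deg := (mdegA L).

(** The sum of the coefficients in degree [c], written as an evaluation at (1, ..., 1) to make it
    compatible with products. These linear forms cut out the lattice ideal. *)
Definition csum c p : k := (hpart c p).@[fun=> 1].

Fact csum_linear c : scalar (csum c).
Proof. by move=> a p q; rewrite /csum /hpart linearP /= mevalD mevalZ. Qed.
HB.instance Definition _ c :=
  GRing.isLinear.Build k {mpoly k[n]} k _ (csum c) (csum_linear c).

Lemma csumX c u : csum c 'X_[u] = (deg u == c)%:R.
Proof.
have [<-|uc] := eqVneq (deg u) c.
  rewrite /csum /hpart mfilter_id ?mevalX ?big1 // => [i _|m].
    by rewrite expr1n.
  by rewrite msuppX inE => /eqP ->.
rewrite /csum (_ : hpart c 'X_[u] = 0) ?meval0 //; apply/mpolyP => m.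
rewrite mcoeff0 mcoeff_mfilter mcoeffX.
case: (u =P m) => [<-|]; last by rewrite if_same.
by rewrite (negPf uc).
Qed.

Lemma csumMX c p u : csum c (p * 'X_[u]) = csum (c - deg u) p.
Proof.
rewrite /csum -{1}(subrK (deg u) c) hpartMr => [|m]; last first.
  by rewrite msuppX inE => /eqP ->.
by rewrite mevalM mevalX big1 ?mulr1 // => i _; rewrite expr1n.
Qed.

Lemma csumE c p : csum c p = \sum_(m <- msupp p | deg m == c) p@_m.
Proof.
rewrite {1}[p]mpolyE linear_sum [RHS]big_mkcond /=; apply: eq_bigr => m _.
by rewrite linearZ /= csumX; case: ifP; rewrite ?mulr1 ?mulr0.
Qed.

(** Both monomials of a generating binomial have the same degree. Conversely, subtract from each
    monomial of [p] a fixed representative of its degree: the representative of degree c is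
    subtracted with total coefficient [csum c p], which is 0. *)
Lemma lattice_idealP p : lattice_ideal L p <-> forall c, csum c p = 0.
Proof.
split=> [[s sS ->] c|p0].
  rewrite linear_sum /= big_seq big1 // => q /sS[u [v [uv ->]]].
  rewrite mulrBr raddfB /= !csumMX; move: uv; rewrite -mdegA_eqE => /eqP ->.
  by rewrite subrr.
pose rep c := nth 0%MM (msupp p) (find (fun m => deg m == c) (msupp p)).
have repP m : m \in msupp p -> deg (rep (deg m)) = deg m.
  move=> mp; have h : has (fun m' => deg m' == deg m) (msupp p).
    by apply/hasP; exists m.
  exact/eqP/(nth_find 0%MM h).
have e : p = \sum_(m <- msupp p) (p@_m)%:MP * ('X_[m] - 'X_[rep (deg m)]).
  under eq_bigr => m _ do rewrite mulrBr.
  rewrite sumrB.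
  have -> : \sum_(m <- msupp p) (p@_m)%:MP * 'X_[k, rep (deg m)] = 0.
    apply/mpolyP => w; rewrite raddf_sum mcoeff0 /=.
    transitivity (if rep (deg w) == w then csum (deg w) p else 0).
      rewrite csumE; case: ifP => rw.
        rewrite [RHS]big_mkcond /= !big_seq; apply: eq_bigr => m mp.
        rewrite mcoeffCM mcoeffX; case: ifP => [/eqP ->|mw]; first by rewrite rw mulr1.
        case: eqP => [e|]; last by rewrite mulr0.
        by rewrite -(repP m mp) e eqxx in mw.
      rewrite big_seq big1 // => m mp; rewrite mcoeffCM mcoeffX.
      case: eqP => [e|]; last by rewrite mulr0.
      by move: rw; rewrite -{1}e repP // e eqxx.
    by rewrite p0 if_same.
  rewrite subr0 {1}[p]mpolyE; apply: eq_bigr => m _; exact: esym (mul_mpolyC _ _).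
rewrite e; apply: ideal_gen_sum => m mp; apply: ideal_genM.
exists [:: (1, 'X_[m] - 'X_[rep (deg m)])]; last by rewrite big_seq1 mul1r.
move=> q; rewrite inE => /eqP ->; exists m, (rep (deg m)); split=> //=.
by rewrite -mdegA_eqE repP.
Qed.
End LatticeIdeal.

(** * Koszul strands *)

Section Slices.
Variables (k : fieldType) (U X Y : finType).

Definition slice (Z : finType) (f : {ffun {set U} * Z -> k^o}) F :
    {ffun Z -> k^o} := [ffun x => f (F, x)].

Definition slicewise (h : {ffun X -> k^o} -> {ffun Y -> k^o})
    (f : {ffun {set U} * X -> k^o}) : {ffun {set U} * Y -> k^o} :=
  [ffun p : {set U} * Y => h (slice f p.1) p.2].

Lemma slice_linear Z F : linear (fun f => @slice Z f F).
Proof. by move=> a f g; apply/ffunP => x; rewrite !ffunE. Qed.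

Lemma slicewise_linear (h : {linear {ffun X -> k^o} -> {ffun Y -> k^o}}) :
  linear (slicewise h).
Proof.
move=> a f g; apply/ffunP => p; rewrite !ffunE slice_linear linearP.
by rewrite !ffunE.
Qed.
HB.instance Definition _ (h : {linear {ffun X -> k^o} -> {ffun Y -> k^o}}) :=
  GRing.isLinear.Build k {ffun {set U} * X -> k^o} {ffun {set U} * Y -> k^o}
    _ (slicewise h) (slicewise_linear h).

Lemma slice_slicewise h f F : slice (slicewise h f) F = h (slice f F).
Proof. by apply/ffunP => x; rewrite !ffunE. Qed.

Lemma slice_bdry (Z : finType) (f : {ffun {set U} * Z -> k^o}) F :
  slice (bdry f) F = \sum_(v | v \notin F) bsign k v F *: slice f (v |: F).
Proof.
apply/ffunP => x; rewrite !ffunE sum_ffunE; apply: eq_bigr => v _.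
by rewrite !ffunE.
Qed.

Lemma bdry_slicewise (h : {linear {ffun X -> k^o} -> {ffun Y -> k^o}}) f :
  bdry (slicewise h f) = slicewise h (bdry f).
Proof.
apply/ffunP => -[F y]; rewrite [RHS]ffunE /= slice_bdry linear_sum sum_ffunE /=.
by rewrite ffunE /=; apply: eq_bigr => v _; rewrite linearZ !ffunE.
Qed.
End Slices.

Lemma eq_slice (k : fieldType) (U X : finType) (f g : {ffun {set U} * X -> k^o}) :
  (forall F, slice f F = slice g F) -> f = g.
Proof.
by move=> e; apply/ffunP => -[F x]; have /ffunP/(_ x) := e F; rewrite !ffunE.
Qed.

(** * Polynomial vectors of bounded total degree as a finite-dimensional space *)

Section Coordinates.
Variables (k : fieldType) (n D r : nat).
Local Notation coords := {ffun 'I_r * 'X_{1..n < D} -> k^o}.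

Definition from_coords (f : coords) : 'rV[{mpoly k[n]}]_r :=
  \row_a \sum_(w : 'X_{1..n < D}) f (a, w) *: 'X_[w].
Definition to_coords (v : 'rV[{mpoly k[n]}]_r) : coords :=
  [ffun p : 'I_r * 'X_{1..n < D} => (v 0 p.1)@_(p.2) : k^o].

Lemma from_coordsP a f g :
  from_coords (a *: f + g) = a%:MP *: from_coords f + from_coords g.
Proof.
apply/rowP => j; rewrite !mxE mul_mpolyC scaler_sumr -big_split /=.
by apply: eq_bigr => w _; rewrite !ffunE scalerDl scalerA.
Qed.

Lemma from_coords0 : from_coords 0 = 0.
Proof.
by apply/rowP => j; rewrite !mxE big1 // => w _; rewrite ffunE scale0r.
Qed.

Lemma from_coords_sum (I : finType) (P : pred I) (c : I -> k) (f : I -> coords) :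
  from_coords (\sum_(i | P i) c i *: f i) =
  \sum_(i | P i) (c i)%:MP *: from_coords (f i).
Proof.
elim/big_rec2: _ => [|i v g _ <-]; first exact: from_coords0.
exact: from_coordsP.
Qed.

Lemma mcoeff_from_coords f j (w : 'X_{1..n < D}) :
  (from_coords f 0 j)@_w = f (j, w).
Proof.
rewrite mxE raddf_sum (bigD1 w) //= mcoeffZ mcoeffX eqxx mulr1 big1 ?addr0 //.
move=> w' w'w; rewrite mcoeffZ mcoeffX; case: eqP => [/val_inj e|]; rewrite ?mulr0 //.
by rewrite e eqxx in w'w.
Qed.

Lemma from_coords_bound f j m : m \in msupp (from_coords f 0 j) -> (mdeg m < D)%N.
Proof.
rewrite mcoeff_msupp mxE raddf_sum /=; apply: contraNT; rewrite -leqNgt => Dm.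
apply/eqP/big1 => w _; rewrite mcoeffZ mcoeffX; case: eqP => [e|]; rewrite ?mulr0 //.
by have := bmdeg w; rewrite e ltnNge Dm.
Qed.

Lemma from_coordsK : cancel from_coords to_coords.
Proof.
by move=> f; apply/ffunP => -[j w]; rewrite ffunE mcoeff_from_coords.
Qed.

Lemma to_coordsK (v : 'rV[{mpoly k[n]}]_r) :
  (forall j m, m \in msupp (v 0 j) -> (mdeg m < D)%N) ->
  from_coords (to_coords v) = v.
Proof.
move=> vD; apply/rowP => j; apply/mpolyP => m.
case: (ltnP (mdeg m) D) => mD.
  by rewrite -[m]/(val (BMultinom mD)) mcoeff_from_coords ffunE.
transitivity (0 : k); last apply/esym; apply/eqP; rewrite mcoeff_eq0.
  by apply/negP => /from_coords_bound; rewrite ltnNge mD.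
by apply/negP => /vD; rewrite ltnNge mD.
Qed.

Lemma to_coordsP a (v w : 'rV[{mpoly k[n]}]_r) :
  to_coords (a%:MP *: v + w) = a *: to_coords v + to_coords w.
Proof. by apply/ffunP => p; rewrite !ffunE !mxE mcoeffD mcoeffCM. Qed.
End Coordinates.

Section MulCoords.
Variables (k : fieldType) (n D r s : nat) (M : 'M[{mpoly k[n]}]_(r, s)).

Definition mulcoords (f : {ffun 'I_r * 'X_{1..n < D} -> k^o}) :
  {ffun 'I_s * 'X_{1..n < D} -> k^o} := to_coords D (from_coords f *m M).

Fact mulcoords_linear : linear mulcoords.
Proof.
by move=> a f g; rewrite /mulcoords from_coordsP mulmxDl -scalemxAl to_coordsP.
Qed.
HB.instance Definition _ :=
  GRing.isLinear.Build k {ffun 'I_r * 'X_{1..n < D} -> k^o}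
    {ffun 'I_s * 'X_{1..n < D} -> k^o} _ mulcoords mulcoords_linear.
End MulCoords.

(** On R_b this is the augmentation to k with kernel the degree-b part of I_L; it joins the
    resolution to the chains of the divisor complex. *)
Definition sumcoords (k : fieldType) (I : finType) (f : {ffun I -> k^o}) :
  {ffun unit -> k^o} := [ffun=> \sum_x f x].

Fact sumcoords_linear (k : fieldType) (I : finType) : linear (@sumcoords k I).
Proof.
move=> a f g; apply/ffunP => x; rewrite !ffunE scaler_sumr -big_split /=.
by apply: eq_bigr => y _; rewrite !ffunE.
Qed.
HB.instance Definition _ (k : fieldType) (I : finType) :=
  GRing.isLinear.Build k {ffun I -> k^o} {ffun unit -> k^o} _ (@sumcoords k I)
    (@sumcoords_linear k I).

Definition nsupp n (m : 'X_{1..n}) : {set 'I_n} := [set l | m l != 0%N].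

Definition indicator n (F : {set 'I_n}) : 'X_{1..n} :=
  [multinom nat_of_bool (i \in F) | i < n].

Lemma indicator_le n (F : {set 'I_n}) (m : 'X_{1..n}) :
  (indicator F <= m)%MM = (F \subset nsupp m).
Proof.
apply/mnm_lepP/subsetP => h l.
  by move=> lF; have := h l; rewrite mnmE lF inE lt0n.
by rewrite mnmE; case: (boolP (l \in F)) => // /h; rewrite inE lt0n.
Qed.

Section Strand.
Variables (k : fieldType) (n : nat) (L : zmodClosed 'rV[int]_n).
Variables (rk : nat -> nat) (sh : forall i, 'I_(rk i) -> lattice_quot L).
Variable df : forall i, 'M[{mpoly k[n]}]_(rk i.+1, rk i).
Hypothesis rk0 : rk 0 = 1%N.
Hypothesis sh0 : forall a, @sh 0%N a = 0.
Hypothesis dfH : forall i, homog_map (@sh i.+1) (@sh i) (df i).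
Local Notation deg := (mdegA L).

(** In degree 0 this is the kernel of R -> R/I_L, so exactness reads the same in all degrees. *)
Definition cycle i : 'rV[{mpoly k[n]}]_(rk i) -> Prop :=
  match i with
  | 0 => fun v => forall j, lattice_ideal L (v 0 j)
  | i'.+1 => fun v => v *m df i' = 0
  end.

(** The equivalence includes that consecutive maps compose to zero. It is stated degree by degree in
    order to apply to a resolution still under construction. *)
Definition exact_at i := forall v, @cycle i v <-> exists w, v = w *m df i.

Lemma cycleD i (v w : 'rV_(rk i)) : cycle v -> cycle w -> cycle (v + w).
Proof.
case: i v w => [|i] v w /= cv cw; last by rewrite mulmxDl cv cw addr0.
by move=> j; rewrite mxE; apply: ideal_genD; [exact: cv | exact: cw].
Qed.

Lemma cycleZ i p (v : 'rV_(rk i)) : cycle v -> cycle (p *: v).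
Proof.
case: i v => [|i] v /= cv; last by rewrite -scalemxAl cv scaler0.
by move=> j; rewrite mxE; apply: ideal_genM; exact: cv.
Qed.

Lemma cycle0 i : cycle (0 : 'rV_(rk i)).
Proof.
case: i => [|i] /=; last by rewrite mul0mx.
by move=> j; rewrite mxE; exists [::]; rewrite ?big_nil.
Qed.

(** Monomials are nonzerodivisors on R/I_L, because multiplication by x^u only shifts the degrees of
    the coefficient sums, and on free modules. *)
Lemma cycle_divX i u (v : 'rV_(rk i)) : cycle ('X_[u] *: v) -> cycle v.
Proof.
case: i v => [|i] v /=.
  move=> cv j; apply/lattice_idealP => c.
  have /lattice_idealP/(_ (c + deg u)) := cv j.
  by rewrite mxE mulrC csumMX addrK.
rewrite -scalemxAl => /rowP e; apply/rowP => j; apply/eqP.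
have := e j; rewrite !mxE => /eqP; rewrite mulf_eq0 => /orP[/eqP X0|//].
have := mcoeffX k u u; rewrite X0 mcoeff0 eqxx => /esym/eqP.
by rewrite oner_eq0.
Qed.

Lemma cycle_hcomp i c (v : 'rV_(rk i)) : cycle v -> cycle (hcomp (@sh i) c v).
Proof.
case: i v => [|i] v /= cv; last first.
  rewrite (hcomp_mulmx _ _ (@dfH i)) cv; apply/rowP => j.
  by rewrite !mxE linear0.
move=> j; apply/lattice_idealP => e; rewrite mxE sh0 subr0.
have /lattice_idealP cvj := cv j.
have [<-|ec] := eqVneq c e.
  rewrite -[RHS](cvj c) /csum; congr (_.@[_]); apply: mfilter_id => m.
  by rewrite mfilter_msupp => /andP[].
rewrite csumE big_seq_cond big1 // => m /andP[mc /eqP me].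
by move: mc; rewrite mfilter_msupp me eq_sym (negPf ec).
Qed.

Section Degree.
Variables (b : lattice_quot L) (D : nat).
Hypothesis degD : forall i a (w : 'X_{1..n}), deg w + @sh i a = b -> (mdeg w < D)%N.
Variable Delta : pred {set 'I_n}.
Hypothesis DeltaP : forall F, F != set0 ->
  Delta F <-> exists2 u : 'X_{1..n}, deg u = b & F \subset nsupp u.
Hypothesis Delta_down : forall v T, Delta (v |: T) -> Delta T.

(* The degree-b strand of Koszul (x) G, augmented by the chains of Delta: for
   i > 0 a chain assigns to F an element of degree b of G_(i-1) divisible by x^F
   (rather than an element of degree b - deg x^F), so that [sdiff] is the
   differential of G on each F and [sbdry] is a simplicial boundary.  By [degD]
   no monomial is lost in the truncation at [D]. *)
Definition stype i : finType :=
  match i with 0 => unit : finType | i'.+1 => ('I_(rk i') * 'X_{1..n < D})%type end.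

Definition strand i : vectType k := {ffun {set 'I_n} * stype i -> k^o}.

Definition sdiff i : 'Hom(strand i.+1, strand i) :=
  match i return 'Hom(strand i.+1, strand i) with
  | 0 => linfun (slicewise (@sumcoords k (stype 1)))
  | i'.+1 => linfun (slicewise (@mulcoords k n D _ _ (df i')))
  end.

Definition sbdry i : 'End(strand i) := linfun (@bdry k 'I_n (stype i)).

Definition scell i : pred ({set 'I_n} * ('I_(rk i) * 'X_{1..n < D})) :=
  fun p => (p.1 \subset nsupp p.2.2) && (deg p.2.2 + sh p.2.1 == b).

Definition spart i : nat -> {vspace strand i} :=
  match i return nat -> {vspace strand i} with
  | 0 => fun j => suppv k (layer (complex_at tt Delta) j)
  | i'.+1 => fun j => suppv k (layer (@scell i') j)
  end.

Lemma sdiff_bdry i x : sdiff i (sbdry i.+1 x) = sbdry i (sdiff i x).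
Proof.
case: i x => [|i] x; rewrite /sdiff /sbdry !lfunE /=.
  by rewrite (bdry_slicewise (@sumcoords k (stype 1))).
by rewrite (bdry_slicewise (@mulcoords k n D _ _ (df i))).
Qed.

Lemma scell_down i : down_closed (@scell i).
Proof.
move=> F v [a w] /andP[/= /subsetP Fw e]; rewrite /scell /= e andbT.
by apply/subsetP => l lF; apply: Fw; rewrite inE lF orbT.
Qed.

Lemma sbdry_part i j : (sbdry i.+1 @: spart i.+1 j.+1 <= spart i.+1 j)%VS.
Proof. exact: bdry_layer (@scell_down i). Qed.

(** For a fixed monomial the faces form the full simplex on its support, a cone with apex any
    variable dividing it. For the monomial 1 only the empty face is left, and exactness fails in
    cardinality 0: this is where Tor appears. *)
Lemma sbdry_exact i j :
  (spart i.+1 j.+1 :&: lker (sbdry i.+1) = sbdry i.+1 @: spart i.+1 j.+2)%VS.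
Proof.
apply: bdry_exact; first exact: scell_down.
exists (fun x : stype i.+1 => [pick l | l \in nsupp x.2]) => F [a w].
move=> /andP[/= cF /andP[/= Fw e]]; case: pickP => [v vw|w0].
  by exists v; rewrite // /scell /= e andbT subUset sub1set vw.
have /card_gt0P[l lF] : (0 < #|F|)%N by rewrite (eqP cF).
by have := w0 l; rewrite (subsetP Fw).
Qed.

Definition admissible i (F : {set 'I_n}) (v : 'rV[{mpoly k[n]}]_(rk i)) :=
  homog_elt (@sh i) b v /\ forall a m, m \in msupp (v 0 a) -> F \subset nsupp m.

Definition svec i (f : strand i.+1) F : 'rV[{mpoly k[n]}]_(rk i) :=
  from_coords (slice f F).

Lemma spartP i j (f : strand i.+1) :
  f \in spart i.+1 j <->
  forall F, admissible F (svec f F) /\ (#|F| != j -> svec f F = 0).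
Proof.
split=> [fP F|h].
  split; last first.
    move=> Fj; apply/rowP => a; rewrite !mxE big1 // => w _; rewrite ffunE.
    by rewrite (suppvP _ _ fP) ?scale0r // /layer /= (negPf Fj).
  have fE a m : m \in msupp (svec f F 0 a) ->
      F \subset nsupp m /\ deg m + sh a = b.
    move=> mf; have mD := from_coords_bound mf.
    move: mf; rewrite -[m]/(val (BMultinom mD)) mcoeff_msupp mcoeff_from_coords.
    rewrite ffunE => /(suppvPn fP) /andP[_ /andP[/= -> /eqP ->]].
    by [].
  by split=> [a m /fE[]|a m /fE[]].
apply/suppvP => -[F [a w]] np; have [[h1 h2] h3] := h F.
have -> : f (F, (a, w)) = (svec f F 0 a)@_w by rewrite mcoeff_from_coords ffunE.
apply/eqP; rewrite mcoeff_eq0; apply: contraNN np => mf.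
rewrite /layer /scell /= (h2 a w mf) (h1 a w mf) eqxx !andbT.
by apply: contraTT mf => /h3 ->; rewrite mxE msupp0.
Qed.

Lemma admissible_mulmx i F (v : 'rV_(rk i.+1)) :
  admissible F v -> admissible F (v *m df i).
Proof.
move=> [vb vF]; split.
  by rewrite -(hcomp_id vb) (hcomp_mulmx _ _ (@dfH i)); apply: hcomp_homog.
have /fin_all_exists[q qE] a : exists q, v 0 a = q * 'X_[indicator F].
  by apply: mdivX => m /vF; rewrite indicator_le.
move=> a m; rewrite mxE (_ : \sum_j _ = (\sum_j q j * df i j a) * 'X_[indicator F]).
  rewrite (perm_mem (msuppMX _ _)) => /mapP[m' _ ->].
  by rewrite -indicator_le lem_addr.
by rewrite mulr_suml; apply: eq_bigr => j _; rewrite qE mulrAC.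
Qed.

Lemma admissible_bound i F (v : 'rV_(rk i)) : admissible F v ->
  forall j m, m \in msupp (v 0 j) -> (mdeg m < D)%N.
Proof. by move=> [vb _] j m /vb /degD. Qed.

Lemma svec_sdiff i F (f : strand i.+2) j : f \in spart i.+2 j ->
  svec (sdiff i.+1 f) F = svec f F *m df i.
Proof.
move=> /spartP/(_ F)[fa _]; rewrite /svec lfunE /= slice_slicewise.
by apply: to_coordsK; apply: admissible_bound (admissible_mulmx fa).
Qed.

Lemma sdiff_kerP i j (f : strand i.+1) : f \in spart i.+1 j ->
  f \in lker (sdiff i) <-> forall F, cycle (svec f F).
Proof.
move=> fP; rewrite memv_ker; case: i f fP => [|i] f fP; last first.
  split=> [/eqP f0 F|h] /=.
    by rewrite -(svec_sdiff F fP) f0 /svec (_ : slice 0 F = 0) ?from_coords0 //;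
      apply/ffunP => x; rewrite !ffunE.
  apply/eqP/eq_slice => F; apply: (can_inj (@from_coordsK k n D _)).
  rewrite -/(svec _ _) (svec_sdiff F fP); have /= -> := h F.
  by rewrite (_ : slice 0 F = 0) ?from_coords0 //; apply/ffunP => x; rewrite !ffunE.
have [a0 a0P] : exists a0 : 'I_(rk 0), forall a, a = a0.
  rewrite /= rk0; exists ord0 => a; exact: ord1.
have sumE F : sumcoords (slice f F) tt = csum b (svec f F 0 a0).
  have [[fb _] _] := (spartP _ _).1 fP F.
  rewrite ffunE /csum /hpart mfilter_id; last first.
    by move=> m /fb <-; rewrite sh0 addr0.
  rewrite mxE raddf_sum (eq_bigr (fun p => slice f F (a0, p.2))); last first.
    by move=> [a w] _; rewrite (a0P a).
  rewrite -(pair_big xpredT xpredT (fun a w => slice f F (a0, w))) /=.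
  rewrite (bigD1 a0) //= [X in _ + X]big1 ?addr0 => [|a]; last first.
    by rewrite (a0P a) eqxx.
  apply: eq_bigr => w _; rewrite mevalZ mevalX big1 ?mulr1 // => l _.
  by rewrite expr1n.
split=> [/eqP f0 F a|h].
  rewrite (a0P a); apply/lattice_idealP => c.
  have [<-|bc] := eqVneq b c.
    rewrite -sumE; move: f0; rewrite lfunE /= => /ffunP/(_ (F, tt)).
    by rewrite !ffunE.
  have [[fb _] _] := (spartP _ _).1 fP F.
  rewrite csumE big_seq_cond big1 // => m /andP[/fb].
  by rewrite sh0 addr0 => -> /eqP e; rewrite e eqxx in bc.
apply/eqP; rewrite lfunE; apply/ffunP => -[F []]; rewrite ffunE /= sumE ffunE.
by have /lattice_idealP := h F a0.
Qed.

(** Divide by x^F, which preserves cycles, lift, multiply back and keep the degree-b part. The last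
    clause keeps the lift of a chain within the same cardinality of faces. *)
Lemma cycle_lift i F (v : 'rV_(rk i)) : exact_at i -> cycle v ->
  admissible F v -> exists w, [/\ v = w *m df i, admissible F w & (v = 0 -> w = 0)].
Proof.
move=> ex cv va; have [->|v0] := eqVneq v 0.
  exists 0; split=> //; first by rewrite mul0mx.
  by split=> a m; rewrite mxE msupp0.
have /fin_all_exists[q qE] a : exists q, v 0 a = q * 'X_[indicator F].
  by apply: mdivX => m; rewrite indicator_le; apply: va.2.
have vq : v = 'X_[indicator F] *: \row_a q a.
  by apply/rowP => a; rewrite !mxE qE mulrC.
have /ex[w wq] : cycle (\row_a q a).
  by apply: (@cycle_divX _ (indicator F)); rewrite -vq.
exists (hcomp (@sh i.+1) b ('X_[indicator F] *: w)); split.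
- rewrite (hcomp_mulmx _ _ (@dfH i)) -scalemxAl -wq -vq.
  by rewrite hcomp_id //; case: va.
- split; first exact: hcomp_homog.
  move=> a m /hcomp_msupp; rewrite mxE mulrC (perm_mem (msuppMX _ _)).
  by move=> /mapP[m' _ ->]; rewrite -indicator_le lem_addr.
by move=> e; rewrite e eqxx in v0.
Qed.

Lemma sdiff_exact i j : exact_at i ->
  (sdiff i.+1 @: spart i.+2 j = spart i.+1 j :&: lker (sdiff i))%VS.
Proof.
move=> ex; apply/vspaceP => g; rewrite memv_cap; apply/memv_imgP/andP.
  move=> [f fP ->].
  have gP : sdiff i.+1 f \in spart i.+1 j.
    apply/spartP => F; rewrite (svec_sdiff F fP).
    have [fa f0] := (spartP _ _).1 fP F; split; first exact: admissible_mulmx.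
    by move/f0 ->; rewrite mul0mx.
  split=> //; apply/(sdiff_kerP gP) => F; rewrite (svec_sdiff F fP).
  by apply/ex; eexists.
move=> [gP /(sdiff_kerP gP) gc].
have /fin_all_exists[w wP] F : exists w, [/\ svec g F = w *m df i,
    admissible F w & (svec g F = 0 -> w = 0)].
  by apply: cycle_lift => //; case: ((spartP _ _).1 gP F).
pose f : strand i.+2 := [ffun p : {set 'I_n} * stype i.+2 =>
  to_coords D (w p.1) p.2].
have fE F : svec f F = w F.
  rewrite /svec (_ : slice f F = to_coords D (w F)); last first.
    by apply/ffunP => x; rewrite !ffunE.
  by apply: to_coordsK; case: (wP F) => _ /admissible_bound.
have fP : f \in spart i.+2 j.
  apply/spartP => F; rewrite fE; have [_ wa w0] := wP F; split=> // Fj.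
  by apply: w0; case: ((spartP _ _).1 gP F) => _; apply.
exists f => //; apply: eq_slice => F; apply: (can_inj (@from_coordsK k n D _)).
by rewrite -!/(svec _ _) (svec_sdiff F fP) fE; case: (wP F).
Qed.

(** A nonempty face F of Delta has a monomial of degree [b] divisible by x^F, and the preimage puts
    the whole value at F on one such monomial. The empty face is excluded, as it may belong to Delta
    when no monomial has degree [b]. *)
Lemma sdiff_onto j : (sdiff 0 @: spart 1 j.+1 = spart 0 j.+1)%VS.
Proof.
apply/vspaceP => g; apply/memv_imgP/idP.
  move=> [f fP ->]; rewrite lfunE /=; apply/suppvP => -[F []] np.
  rewrite !ffunE big1 // => -[a w] _; rewrite ffunE /=.
  apply: (suppvP _ _ fP); apply: contraNN np => /andP[/= cF /andP[/= Fw e]].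
  rewrite /layer /complex_at /= cF /=; apply/DeltaP.
    by rewrite -card_gt0 (eqP cF).
  by exists w => //; rewrite -(eqP e) sh0 addr0.
move=> gP; pose u (F : {set 'I_n}) :=
  [pick w : 'X_{1..n < D} | (deg w == b) && (F \subset nsupp w)].
exists ([ffun p : {set 'I_n} * stype 1 =>
   (if u p.1 == Some p.2.2 then g (p.1, tt) else 0) : k^o]).
  apply/suppvP => -[F [a w]] np; rewrite ffunE /=; case: eqP => // uw.
  apply: (suppvP _ _ gP); apply: contraNN np => /andP[/= cF _].
  rewrite /layer /scell /= cF sh0 addr0.
  by move: uw; rewrite /u; case: pickP => // w' /andP[h1 h2] [<-]; rewrite h1 h2.
rewrite lfunE /=; apply/ffunP => -[F []]; rewrite !ffunE.
under eq_bigr => x _ do rewrite !ffunE /=.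
rewrite -(pair_big xpredT xpredT
  (fun (a : 'I_(rk 0)) w => if u F == Some w then g (F, tt) else 0)) /=.
rewrite sumr_const card_ord rk0 mulr1n.
case uF: (u F) => [w|].
  rewrite (bigD1 w) //= eqxx big1 ?addr0 // => w' w'w; case: eqP => // -[e].
  by rewrite e eqxx in w'w.
rewrite big1 //; apply: (suppvP _ _ gP); apply/negP => /andP[/= cF /andP[_ /= Fd]].
have F0 : F != set0 by rewrite -card_gt0 (eqP cF).
have [w wb Fw] := (DeltaP F0).1 Fd.
have [a0 _] : exists a0 : 'I_(rk 0), True by rewrite rk0; exists ord0.
have wD : (mdeg w < D)%N by apply: (@degD 0%N a0); rewrite sh0 addr0.
move: uF; rewrite /u; case: pickP => // /(_ (BMultinom wD)).
by rewrite /= wb eqxx Fw.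
Qed.

Lemma sdiff_cycles N : (forall i, (i < N)%N -> exact_at i) ->
  forall i j, (i <= N)%N ->
  (sdiff i @: spart i.+1 j.+1 = @cycles k strand sdiff spart i j.+1)%VS.
Proof.
by move=> ex [|i] j iN; [apply: sdiff_onto | apply: sdiff_exact; apply: ex].
Qed.

(* The left-hand side is the dimension of (Z_N :&: m G_N)_b, where Z_N is the
   module of cycles of G_N; the last term is that of (m Z_N)_b. *)
Lemma homology_strand N : (forall i, (i < N)%N -> exact_at i) ->
  \dim ((spart N.+1 0 :&: lker (sdiff N)) :&: (sbdry N.+1 @: spart N.+1 1)) =
  (reduced_homology_dim k Delta N +
   \dim (sbdry N.+1 @: (spart N.+1 1 :&: lker (sdiff N))))%N.
Proof.
move=> ex; have := dim_zigzag sdiff_bdry sbdry_part sbdry_exact (sdiff_cycles ex).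
rewrite (reduced_homology_dimE k tt Delta_down).
set a := (\dim (spart 0 _ :&: _)); set d := \dim (sbdry 0 @: _).
have da : (d <= a)%N.
  apply: dimvS; rewrite subv_cap; apply/andP; split.
    exact: bdry_layer (complex_at_down Delta_down).
  apply/subvP => _ /memv_imgP[f _ ->].
  by rewrite memv_ker /sbdry !lfunE /= bdry_bdry.
have subn_eq (x y z : nat) : (a + x = y + d -> y = a - d + x)%N by lia.
exact: subn_eq.
Qed.


Lemma svec_sbdry i (f : strand i.+1) F :
  svec (sbdry i.+1 f) F = \sum_(v | v \notin F) (bsign k v F)%:MP *: svec f (v |: F).
Proof. by rewrite /svec /sbdry lfunE /= slice_bdry from_coords_sum. Qed.

Lemma nsupp0 : nsupp (0%MM : 'X_{1..n}) = set0.
Proof. by apply/setP => l; rewrite !inE mnm0E. Qed.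

Lemma sbdry0P i (f : strand i.+1) : f \in spart i.+1 0 ->
  f \in (sbdry i.+1 @: spart i.+1 1)%VS <-> forall a, (svec f set0 0 a)@_0%MM = 0.
Proof.
move=> fP; split=> [/memv_imgP[g gP ->] a|f0].
  rewrite svec_sbdry summxE raddf_sum big1 //= => l _.
  rewrite mxE mcoeffCM (_ : (_)@_0%MM = 0) ?mulr0 //; apply/eqP.
  rewrite mcoeff_eq0; apply/negP => m0.
  have [[_ /(_ a _ m0) lF] _] := (spartP _ _).1 gP (l |: set0).
  by move: lF; rewrite nsupp0 subUset sub1set inE.
(* Without the monomial 1 every support is nonempty, so the cone argument also works in cardinality
   0. *)
pose K : pred ({set 'I_n} * ('I_(rk i) * 'X_{1..n < D})) :=
  fun p => scell p && (nsupp p.2.2 != set0).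
have Kd : down_closed K by move=> F v x /andP[/scell_down h1 h2]; apply/andP.
have fK : f \in suppv k (layer K 0).
  apply/suppvP => -[F [a w]] np; apply/eqP; apply: contraNT np => fp.
  have /andP[/= cF sF] := suppvPn fP fp; rewrite /layer /= cF /K sF /=.
  apply: contraNneq fp => w0; move: cF; rewrite cards_eq0 => /eqP F0.
  have <- : (svec f set0 0 a)@_w = f (F, (a, w)).
    by rewrite mcoeff_from_coords ffunE F0.
  rewrite (_ : val w = 0%MM) ?f0 //; apply/mnmP => l; rewrite mnm0E.
  by move/setP/(_ l): w0; rewrite !inE => /negbFE/eqP.
have KS j : (suppv k (layer K j) <= spart i.+1 j)%VS.
  apply/subvP => g /suppvP gK; apply/suppvP => p np; apply: gK.
  by apply: contraNN np => /andP[cj /andP[sp _]]; apply/andP.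
apply: (subvP (limgS (sbdry i.+1) (KS 1%N))).
rewrite /sbdry (bdry_onto k Kd) //.
exists (fun x : stype i.+1 => [pick l | l \in nsupp x.2]) => F [a w].
move=> /andP[/= cF /andP[/andP[/= Fw e] wn]]; case: pickP => [v vw|w0].
  by exists v; rewrite // /K /scell /= e wn !andbT subUset sub1set vw.
by have /set0Pn[l lw] := wn; have := w0 l; rewrite lw.
Qed.

Definition sembed i (v : 'rV[{mpoly k[n]}]_(rk i)) : strand i.+1 :=
  [ffun p : {set 'I_n} * stype i.+1 =>
     (if p.1 == set0 then to_coords D v p.2 else 0) : k^o].

Lemma svec_sembed i (v : 'rV_(rk i)) F : homog_elt (@sh i) b v ->
  svec (sembed v) F = if F == set0 then v else 0.
Proof.
move=> vb; rewrite /svec; case: eqP => [->|/eqP F0].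
  rewrite (_ : slice _ _ = to_coords D v); last first.
    by apply/ffunP => x; rewrite !ffunE /= eqxx.
  by apply: to_coordsK => j m /vb /degD.
rewrite (_ : slice _ _ = 0) ?from_coords0 //.
by apply/ffunP => x; rewrite !ffunE /= (negPf F0).
Qed.

Lemma sembed_part i (v : 'rV_(rk i)) : homog_elt (@sh i) b v ->
  sembed v \in spart i.+1 0.
Proof.
move=> vb; apply/spartP => F; rewrite svec_sembed //; case: eqP => [->|/eqP F0].
  by rewrite cards0; split=> //; split=> // a m _; apply: sub0set.
by split=> //; split=> a m; rewrite mxE msupp0.
Qed.

(** By [homology_strand] the inclusion of (m Z_N)_b in (Z_N :&: m G_N)_b becomes an equality when
    the homology vanishes. *)
Lemma cycle_decomposable N (v : 'rV_(rk N)) :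
  (forall i, (i < N)%N -> exact_at i) -> reduced_homology_dim k Delta N = 0%N ->
  cycle v -> homog_elt (@sh N) b v -> (forall a, (v 0 a)@_0%MM = 0) ->
  exists2 z : 'I_n -> 'rV_(rk N), forall l, cycle (z l) &
    v = \sum_l 'X_l *: z l.
Proof.
move=> ex h0 cv vb v0; have fP := sembed_part vb.
have := homology_strand ex; rewrite h0 add0n => dimE.
have sub : (sbdry N.+1 @: (spart N.+1 1 :&: lker (sdiff N)) <=
   (spart N.+1 0 :&: lker (sdiff N)) :&: (sbdry N.+1 @: spart N.+1 1))%VS.
  apply/subvP => _ /memv_imgP[g gP ->]; move: gP; rewrite memv_cap => /andP[gP gk].
  rewrite !memv_cap memv_img // andbT (subvP (sbdry_part N 0)) ?memv_img //=.
  by move: gk; rewrite !memv_ker sdiff_bdry => /eqP ->; rewrite linear0.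
have : sembed v \in (sbdry N.+1 @: (spart N.+1 1 :&: lker (sdiff N)))%VS.
  have /eqP -> : (sbdry N.+1 @: (spart N.+1 1 :&: lker (sdiff N)) ==
   (spart N.+1 0 :&: lker (sdiff N)) :&: (sbdry N.+1 @: spart N.+1 1))%VS.
    by rewrite eqEdim sub dimE leqnn.
  rewrite !memv_cap fP /=; apply/andP; split.
    apply/(sdiff_kerP fP) => F; rewrite svec_sembed //.
    by case: eqP => // _; apply: cycle0.
  by apply/(sbdry0P fP) => a; rewrite svec_sembed // eqxx.
case/memv_imgP => g; rewrite memv_cap => /andP[gP /(sdiff_kerP gP) gc] e.
(* The value of the chain [g] at the vertex l is a cycle divisible by x_l, and the quotient is again
   a cycle; the boundary at the empty face adds up these values. *)
have /fin_all_exists[z zP] l : exists z, cycle z /\ svec g [set l] = 'X_l *: z.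
  have [[_ gF] _] := (spartP _ _).1 gP [set l].
  have /fin_all_exists[q qE] a : exists q, svec g [set l] 0 a = q * 'X_[U_(l)].
    apply: mdivX => m /gF; rewrite sub1set inE -lt0n => ml.
    by rewrite lep1mP -lt0n.
  have zE : svec g [set l] = 'X_l *: \row_a q a.
    by apply/rowP => a; rewrite qE !mxE mulrC.
  by exists (\row_a q a); split=> //; apply: (@cycle_divX _ U_(l)%MM); rewrite -zE.
exists z => [l|]; first by case: (zP l).
have := svec_sembed set0 vb; rewrite eqxx => <-; rewrite e svec_sbdry.
apply: eq_big => [l|l _]; first by rewrite inE.
have -> : bsign k l set0 = 1.
  rewrite /bsign (_ : [set _ in _ | _] = set0) ?cards0 //.
  by apply/setP => x; rewrite !inE.
by rewrite scale1r setU0; case: (zP l).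
Qed.

(** The left-hand side is the dimension of Tor_(N+1) in degree [b], computed from a resolution that
    may fail to be minimal. It is matched with (Z_N :&: m G_N)_b / (m Z_N)_b by rank-nullity, hence
    with H_N(Delta). *)
Lemma tor_strand (hex : forall i, exact_at i) N
    (E1 := diag_mx (\row_j (sh j == b)%:R) : 'M[k]_(rk N.+1))
    (E2 := diag_mx (\row_j (sh j == b)%:R) : 'M[k]_(rk N.+2))
    (tau := fun i => map_mx (fun p : {mpoly k[n]} => p@_0%MM) (df i)) :
  (\rank E1 - \rank (E1 *m tau N) - \rank (E2 *m tau N.+1) =
   reduced_homology_dim k Delta N)%N.
Proof.
(* Reduction modulo m: constant terms of the value at the empty face. Its kernel in degree [b] is (m
   G_i)_b and its image is the degree-b part of G_i (x) k. *)
pose pi i (f : strand i.+1) : 'rV[k]_(rk i) := \row_a (svec f set0 0 a)@_0%MM.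
have pi_lin i : linear (@pi i).
  move=> c f g; apply/rowP => a; rewrite mxE.
  have -> : svec (c *: f + g) set0 = c%:MP *: svec f set0 + svec g set0.
    by rewrite /svec slice_linear from_coordsP.
  by rewrite mxE mcoeffD mxE mcoeffCM [RHS]mxE [X in _ = X + _]mxE /pi !mxE.
pose piL i : {linear strand i.+1 -> 'rV[k]_(rk i)} :=
  HB.pack (@pi i) (GRing.isLinear.Build _ _ _ _ (@pi i) (pi_lin i)).
pose p i := linfun (piL i).
have pE i f : p i f = pi i f by rewrite lfunE.
pose E i : 'M[k]_(rk i) := diag_mx (\row_j (sh j == b)%:R).
have pker i : (spart i.+1 0 :&: lker (p i) = sbdry i.+1 @: spart i.+1 1)%VS.
  apply/vspaceP => f; rewrite memv_cap memv_ker; apply/andP/idP.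
    move=> [fP]; rewrite pE => /eqP/rowP f0; apply/(sbdry0P fP) => a.
    by have := f0 a; rewrite mxE [RHS]mxE.
  move=> fB; have fP := subvP (sbdry_part i 0) _ fB; split=> //.
  rewrite pE; apply/eqP/rowP => a; rewrite mxE [RHS]mxE.
  exact: ((sbdry0P fP).1 fB).
have pimg i : (p i @: spart i.+1 0 = limg (linfun (mulmxr (E i))))%VS.
  apply/vspaceP => r; apply/memv_imgP/memv_imgP => -[f fP ->].
    exists (p i f); rewrite ?memvf // (lfunE (mulmxr _)) /= pE mul_mx_diag.
    apply/rowP => a; rewrite [RHS]mxE [X in _ * X]mxE.
    case: eqP => [_|/eqP ab]; first by rewrite mulr1.
    rewrite mulr0 mxE; apply/eqP; rewrite mcoeff_eq0; apply/negP => m0.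
    have [[fb _] _] := (spartP _ _).1 fP set0.
    by have := fb _ _ m0; rewrite mdegA0 add0r => e; rewrite e eqxx in ab.
  pose v : 'rV[{mpoly k[n]}]_(rk i) := map_mx (fun c : k => c%:MP) (f *m E i).
  have vb : homog_elt (@sh i) b v.
    move=> a m; rewrite mxE msuppC mul_mx_diag mxE [X in _ * X]mxE.
    have [ab|_] := eqVneq (sh a) b; last by rewrite mulr0 eqxx.
    by case: ifP => // _; rewrite inE => /eqP ->; rewrite mdegA0 add0r.
  exists (sembed v); first exact: sembed_part.
  rewrite (lfunE (mulmxr _)) /= pE; apply/rowP => a.
  by rewrite [RHS]mxE svec_sembed // eqxx [v _ _]mxE mcoeffC eqxx mulr1.
have dimE i : (\dim (spart i.+1 0) =
    \dim (sbdry i.+1 @: spart i.+1 1) + \rank (E i))%N.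
  by rewrite -(limg_ker_dim (p i)) pker pimg dim_limg_mulmxr.
have dimEtau i : (\dim (sdiff i.+1 @: spart i.+2 0) =
    \dim ((spart i.+1 0 :&: lker (sdiff i)) :&: (sbdry i.+1 @: spart i.+1 1)) +
    \rank (E i.+1 *m tau i))%N.
  rewrite -(limg_ker_dim (p i)) (sdiff_exact 0 (hex i)); congr (_ + _)%N.
    rewrite -pker; congr (\dim _); apply/vspaceP => f; rewrite !memv_cap.
    by case: (f \in spart _ _); rewrite //= andbT.
  rewrite -(sdiff_exact 0 (hex i)) -dim_limg_mulmxr; congr (\dim _).
  transitivity (linfun (mulmxr (tau i)) @: (p i.+1 @: spart i.+2 0))%VS.
    rewrite -!limg_comp; apply: eq_in_limg => f fP.
    rewrite !comp_lfunE (lfunE (mulmxr _)) /= !pE; apply/rowP => a.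
    rewrite [LHS]mxE (svec_sdiff set0 fP) [RHS]mxE [X in X@__]mxE raddf_sum.
    apply: eq_bigr => j _ /=.
    by rewrite rmorphM [X in _ = X * _]mxE [X in _ = _ * X]mxE.
  rewrite pimg -limg_comp; apply: eq_in_limg => r _.
  by rewrite !comp_lfunE !lfunE /= mulmxA.
have dimker i : (\dim (spart i.+2 0) = \dim (spart i.+2 0 :&: lker (sdiff i.+1)) +
    \dim (sdiff i.+1 @: spart i.+2 0))%N by rewrite limg_ker_dim.
have dimZ i : (\dim (spart i.+2 0 :&: lker (sdiff i.+1)) =
    \dim (sdiff i.+2 @: spart i.+3 0))%N by rewrite (sdiff_exact 0 (hex i.+1)).
(* The differential maps m G_(i+1) onto m Z_i, with kernel Z_(i+1) :&: m G_(i+1). *)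
have dimB i : (\dim (sbdry i.+2 @: spart i.+2 1) =
   \dim ((spart i.+2 0 :&: lker (sdiff i.+1)) :&: (sbdry i.+2 @: spart i.+2 1)) +
   \dim (sbdry i.+1 @: (spart i.+1 1 :&: lker (sdiff i))))%N.
  rewrite -(limg_ker_dim (sdiff i.+1)); congr (_ + _)%N.
    congr (\dim _); apply/vspaceP => f; rewrite !memv_cap [RHS]andbC andbA.
    congr (_ && _).
    by apply/idP/andP => [h|[]//]; rewrite h (subvP (sbdry_part i.+1 0)).
  rewrite -(sdiff_exact 1 (hex i)) -!limg_comp; congr (\dim _).
  by apply: eq_in_limg => f _; rewrite !comp_lfunE sdiff_bdry.
have hN := @homology_strand N (fun i _ => hex i).
have arith (A mA e1 tA XN r1 h mZ tA' X' r2 Zk : nat) :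
  (A = mA + e1 -> tA = XN + r1 -> XN = h + mZ -> tA' = X' + r2 ->
   A = Zk + tA -> Zk = tA' -> mA = X' + mZ -> e1 - r1 - r2 = h)%N by lia.
exact: (arith _ _ _ _ _ _ _ _ _ _ _ _ (dimE N.+1) (dimEtau N) hN
  (dimEtau N.+1) (dimker N) (dimZ N) (dimB N)).
Qed.
End Degree.
End Strand.

(** * Finiteness of the Betti degrees *)

Lemma bigminn_le (I : eqType) (s : seq I) (P : pred I) (F : I -> nat) M i :
  i \in s -> P i -> (\big[minn/M]_(j <- s | P j) F j <= F i)%N.
Proof.
elim: s => // j s IH; rewrite inE big_cons => /orP[/eqP <- ->|iS Pi].
  exact: geq_minl.
by case: ifP => _; rewrite ?geq_min ?IH ?orbT.
Qed.

Section Vanishing.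
Variables (k : fieldType) (U : finType) (K : pred {set U}).
Hypothesis Kdown : forall v T, K (v |: T) -> K T.

Lemma reduced_homology_cone l N :
  (forall F, K F -> K (l |: F)) -> reduced_homology_dim k K N = 0%N.
Proof.
move=> Kl; rewrite (reduced_homology_dimE k tt Kdown).
rewrite -bdry_exact ?subnn //; first exact: complex_at_down.
exists (fun=> Some l) => F x /andP[_ /andP[/= ex /Kl KF]].
by exists l => //; apply/andP.
Qed.

Lemma reduced_homology_no_face N :
  (forall F, K F -> #|F| != N.+1) -> reduced_homology_dim k K N = 0%N.
Proof.
move=> noF; rewrite (reduced_homology_dimE k tt Kdown).
set S := suppv k (layer _ N.+1).
suff /eqP -> : S == 0%VS by rewrite cap0v dimv0.
rewrite -subv0; apply/subvP => f /suppvP f0; rewrite memv0; apply/eqP/ffunP => -[F x].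
rewrite ffunE f0 // /layer /complex_at /=; apply/negP => /andP[cF /noF].
by rewrite cF.
Qed.
End Vanishing.

(** * The divisor complex, its duality with the gcd-complex, and Betti degrees *)

Section DivisorComplex.
Variables (n : nat) (L : zmodClosed 'rV[int]_n).
Local Notation deg := (mdegA L).
Implicit Type C : {fset 'X_{1..n}}.

Definition divides_rel C (l : 'I_n) (u : C) := val u l != 0%N.

Definition divisor_complex C : pred {set 'I_n} := common_right (@divides_rel C).

(** A gcd differs from 1 exactly when one variable divides all the monomials, so the gcd-complex is
    the Dowker dual of the divisor complex for the relation that x_l divides u. *)
Lemma gcd_complexE C : @gcd_complex n C = common_left (@divides_rel C).
Proof.
apply: functional_extensionality => T; rewrite /gcd_complex /common_left.
case: (set_0Vmem T) => [->|[u0 u0T]]; first by rewrite !eqxx.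
case: eqP => //= _; set M := fun l => (\max_(u in T) val u l)%N.
have mE l : (mgcd_set T l != 0%N) = [forall u in T, divides_rel l u].
  rewrite /mgcd_set mnmE -/(M l); apply/idP/forall_inP => [m0 u uT|h].
    rewrite /divides_rel -lt0n; move: m0; rewrite -lt0n => m0.
    by apply: leq_trans m0 (bigminn_le _ _ _ uT); rewrite mem_index_enum.
  (* The starting value of the minimum is positive as well: it is at least the exponent of [u0]. *)
  rewrite -lt0n; elim/big_ind: _ => [|x y x0 y0|u /h]; last by rewrite lt0n.
    apply: (@leq_trans (val u0 l)); first by rewrite lt0n; apply: h.
    by rewrite /M (bigD1 u0) //= leq_maxl.
  by rewrite leq_min x0 y0.
apply/idP/existsP => [/eqP m0|[l]].
  suff /existsP[l lm] : [exists l, mgcd_set T l != 0%N] by exists l; rewrite -mE.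
  apply: contraT => /existsPn h; case: m0; apply/mnmP => l; rewrite mnm0E.
  by have := h l; rewrite negbK => /eqP.
by rewrite -mE => lm; apply: contraNneq lm => ->; rewrite mnm0E.
Qed.

Section Fiber.
Variables (C : {fset 'X_{1..n}}) (b : lattice_quot L).
Hypothesis CP : forall u, u \in C <-> deg u = b.

Lemma divisor_complexP F : F != set0 ->
  divisor_complex C F <-> exists2 u : 'X_{1..n}, deg u = b & F \subset nsupp u.
Proof.
move=> F0; rewrite /divisor_complex /common_right (negPf F0) /=.
split=> [/existsP[u /forall_inP Fu]|[u ub /subsetP Fu]].
  exists (val u); first by apply/CP/valP.
  by apply/subsetP => l /Fu; rewrite inE.
have uC : u \in C by apply/CP.
apply/existsP; exists [` uC]%fset; apply/forall_inP => l /Fu.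
by rewrite inE.
Qed.
End Fiber.

Lemma divisor_complex_down C v T : divisor_complex C (v |: T) -> divisor_complex C T.
Proof. exact: common_right_down. Qed.

Lemma gcd_homologyE (k : fieldType) C N :
  reduced_homology_dim k (@gcd_complex n C) N =
  reduced_homology_dim k (divisor_complex C) N.
Proof. by rewrite gcd_complexE dowker. Qed.

Lemma divisor_homology_large (k : fieldType) C N : (n <= N)%N ->
  reduced_homology_dim k (divisor_complex C) N = 0%N.
Proof.
move=> nN; apply: reduced_homology_no_face; first exact: divisor_complex_down.
move=> F _; rewrite neq_ltn ltnS (leq_trans _ nN) //.
by rewrite -[X in (_ <= X)%N](card_ord n) max_card.
Qed.

(** There are finitely many complexes on n vertices. For each of them the exponents whose degree has
    that complex, with nonzero homology, form an antichain. *)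
Lemma betti_finite (k : fieldType) N : exists B : seq (lattice_quot L),
  forall c C, (forall u, u \in C <-> deg u = c) ->
  reduced_homology_dim k (divisor_complex C) N != 0%N -> c \in B.
Proof.
pose A (D : {set {set 'I_n}}) (u : 'X_{1..n}) := exists C,
  [/\ forall w, w \in C <-> deg w = deg u, D = [set F | divisor_complex C F] &
      reduced_homology_dim k (divisor_complex C) N != 0%N].
have /fin_all_exists[s sP] (D : {set {set 'I_n}}) : exists s : seq 'X_{1..n},
    forall u, A D u <-> u \in s.
  apply: antichain_finite => u v [C [CP DC hC]] [C' [CP' DC' hC']] uv.
  apply/eqP; apply: contraT => nuv.
  have [l lP] : exists l, (u l < v l)%N.
    suff /existsP[l ll] : [exists l, (u l < v l)%N] by exists l.
    apply: contraT => /existsPn h; case/eqP: nuv; apply/mnmP => l.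
    by apply/eqP; rewrite eqn_leq (mnm_lepP uv) leqNgt h.
  (* Multiplying by x^(v - u) shows that the common complex D is a cone. *)
  case/eqP: hC.
  apply: (@reduced_homology_cone k _ _ (@divisor_complex_down C) l) => F KF.
  have [u' u'C Fu'] : exists2 u', deg u' = deg u & F \subset nsupp u'.
    have [->|F0] := eqVneq F set0; first by exists u; rewrite ?sub0set.
    exact: ((divisor_complexP CP F0).1 KF).
  suff : l |: F \in D by rewrite DC inE.
  have lF0 : l |: F != set0 by apply/set0Pn; exists l; rewrite setU11.
  rewrite DC' inE; apply/(divisor_complexP CP' lF0).
  exists (u' + (v - u))%MM; first by rewrite mdegAD u'C -mdegAD addmC submK.
  apply/subsetP => x /setU1P[->|/(subsetP Fu')]; rewrite !inE mnmDE mnmBE; lia.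
exists (flatten [seq [seq deg u | u <- s D] | D <- enum {set {set 'I_n}}]).
move=> c C CP hC; pose D := [set F | divisor_complex C F].
(* Over an empty fibre the empty set is the only face, and it does not have cardinality [N.+1]. *)
have [u uc] : exists u, deg u = c.
  apply: NNPP => nou; case/eqP: hC; apply: reduced_homology_no_face.
    exact: divisor_complex_down.
  move=> F KF; apply/eqP => cF.
  have F0 : F != set0 by rewrite -card_gt0 cF.
  by case: ((divisor_complexP CP F0).1 KF) => u ub _; case: nou; exists u.
apply/flattenP; exists [seq deg u | u <- s D].
  by apply/mapP; exists D; rewrite ?mem_enum.
apply/mapP; exists u => //; apply/sP; exists C; split=> //.
by rewrite uc.
Qed.
End DivisorComplex.

(** * Minimal free resolutions *)

(** Enlarge a subspace contained in [S] by a vector of [S] outside it until none is left; [m] bounds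
    the codimension. This turns undecidable conditions, such as membership in m Z, into
    subspaces. *)
Lemma vspace_of_pred (k : fieldType) (V : vectType k) (S : V -> Prop) :
  S 0 -> (forall a u v, S u -> S v -> S (a *: u + v)) ->
  exists U : {vspace V}, forall v, v \in U <-> S v.
Proof.
move=> S0 Slin.
have step m (U : {vspace V}) : (\dim {:V} - \dim U <= m)%N ->
    (forall v, v \in U -> S v) -> exists U' : {vspace V}, forall v, v \in U' <-> S v.
  elim: m U => [|m IH] U dU US.
    exists U => v; split=> [/US //|_].
    have /eqP -> : U == fullv by rewrite eqEdim subvf /= -subn_eq0 -leqn0.
    exact: memvf.
  have [h|] := classic (forall v, S v -> v \in U); first by exists U; split; auto.
  move=> nh; have [v nv] := not_all_ex_not _ _ nh.
  have [Sv /negP vU] := imply_to_and _ _ nv.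
  apply: (IH (<[v]> + U)%VS) => [|_ /memv_addP[_ /vlineP[a ->] [u uU ->]]]; last first.
    by apply: Slin => //; apply: US.
  have : (\dim U < \dim (<[v]> + U))%N.
    have [le eq] := dimv_leqif_sup (addvSr <[v]> U).
    rewrite ltn_neqAle le andbT eq; apply: contra vU => /subvP; apply.
    by apply: (subvP (addvSl _ _)); apply: memv_line.
  have := dimvS (subvf (<[v]> + U)%VS); lia.
by apply: (step (\dim {:V}) 0%VS) => [|v]; rewrite ?leq_subr // memv0 => /eqP ->.
Qed.

(** * Minimal generators of a graded submodule *)

Section Generators.
Variables (k : fieldType) (n : nat) (L : zmodClosed 'rV[int]_n).
Hypothesis hL : pointed_lattice L.
Local Notation deg := (mdegA L).

Lemma height_bound c : exists D, forall u, deg u = c -> (mdeg u < D)%N.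
Proof.
have [s sP] := fiber_finite hL c; exists (\max_(u <- s) mdeg u).+1 => u uc.
by rewrite ltnS; apply: leq_bigmax_seq; rewrite // sP uc.
Qed.

Lemma in_semigroupD c d : in_semigroup c -> in_semigroup d ->
  @in_semigroup n L (c + d).
Proof. by move=> [u ->] [v ->]; exists (u + v)%MM; rewrite mdegAD. Qed.

Variables (r : nat) (d : 'I_r -> lattice_quot L).
Hypothesis dA : forall j, in_semigroup (d j).
Variable Z : 'rV[{mpoly k[n]}]_r -> Prop.
Hypothesis Z0 : Z 0.
Hypothesis ZD : forall v w, Z v -> Z w -> Z (v + w).
Hypothesis ZM : forall p v, Z v -> Z (p *: v).
Hypothesis Zhcomp : forall c v, Z v -> Z (hcomp d c v).

(** The submodule m Z; minimal generators of Z are lifts of a basis of Z / m Z. *)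
Definition mprod v := exists2 z : 'I_n -> 'rV[{mpoly k[n]}]_r,
  forall l, Z (z l) & v = \sum_l 'X_l *: z l.

Lemma mprod0 : mprod 0.
Proof. by exists (fun=> 0) => //; rewrite big1 // => l _; rewrite scaler0. Qed.

Lemma mprodP p v w : mprod v -> mprod w -> mprod (p *: v + w).
Proof.
move=> [z zZ ->] [y yZ ->]; exists (fun l => p *: z l + y l).
  by move=> l; apply: ZD => //; apply: ZM.
rewrite scaler_sumr -big_split; apply: eq_bigr => l _ /=.
by rewrite scalerDr !scalerA mulrC.
Qed.

Lemma hcomp_mprodE c (z : 'I_n -> 'rV[{mpoly k[n]}]_r) :
  hcomp d c (\sum_l 'X_l *: z l) =
  \sum_l 'X_l *: hcomp d (c - deg U_(l)%MM) (z l).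
Proof.
have h0 : hcomp d c (0 : 'rV[{mpoly k[n]}]_r) = 0.
  by apply/rowP => j; rewrite !mxE linear0.
rewrite (big_morph (hcomp d c) (hcompD d c) h0).
by apply: eq_bigr => l _; rewrite hcompZX.
Qed.

Lemma mprod_hcomp c v : mprod v -> mprod (hcomp d c v).
Proof.
move=> [z zZ ->]; rewrite hcomp_mprodE.
by exists (fun l => hcomp d (c - deg U_(l)%MM) (z l)) => // l; apply: Zhcomp.
Qed.

Local Notation "v %:MX" := (map_mx (fun c : k => c%:MP) v) (at level 2).

Lemma mpoly_comb t (lam : 'rV[k]_t) (N : 'M[{mpoly k[n]}]_(t, r)) :
  lam%:MX *m N = \sum_i (lam 0 i)%:MP *: row i N.
Proof. by rewrite mulmx_sum_row; apply: eq_bigr => i _; rewrite mxE. Qed.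

(** The rows are a basis of a complement of (m Z)_c in Z_c, both taken inside the finite-dimensional
    space of vectors of bounded total degree. *)
Lemma generators_degree c : exists t, exists2 N : 'M[{mpoly k[n]}]_(t, r),
  forall i, Z (row i N) /\ homog_elt d c (row i N) &
  [/\ forall z, Z z -> homog_elt d c z ->
        exists lam : 'rV[k]_t, mprod (z - lam%:MX *m N),
      forall lam : 'rV[k]_t, mprod (lam%:MX *m N) -> lam = 0 &
      (forall z, Z z -> homog_elt d c z -> mprod z) -> t = 0%N].
Proof.
have [D DP] := height_bound c.
have cD (v : 'rV_r) : homog_elt d c v ->
    forall j m, m \in msupp (v 0 j) -> (mdeg m < D)%N.
  move=> vc j m /vc; have [u ->] := dA j; rewrite -mdegAD => /DP.
  by rewrite mdegD; apply: leq_ltn_trans; apply: leq_addr.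
pose from := @from_coords k n D r.
have homP a v w : homog_elt d c v -> homog_elt d c w -> homog_elt d c (a%:MP *: v + w).
  move=> vc wc; apply: homog_eltD => // j m; rewrite mxE mul_mpolyC => /msuppZ_le.
  exact: vc.
have hom0 : homog_elt d c (0 : 'rV[{mpoly k[n]}]_r).
  by move=> j m; rewrite mxE msupp0.
have fromP a f g : from (a *: f + g) = a%:MP *: from f + from g.
  exact: from_coordsP.
have vsp (Y : 'rV[{mpoly k[n]}]_r -> Prop) : Y 0 ->
    (forall p v w, Y v -> Y w -> Y (p *: v + w)) ->
    exists W : {vspace {ffun 'I_r * 'X_{1..n < D} -> k^o}},
    forall f, f \in W <-> Y (from f) /\ homog_elt d c (from f).
  move=> Y0 YP; apply: vspace_of_pred; first by rewrite /from from_coords0.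
  move=> a f g [Yf hf] [Yg hg]; rewrite fromP.
  by split; [apply: YP | apply: homP].
have [UZ UZP] := vsp Z Z0 (fun p v w Zv Zw => ZD (ZM p Zv) Zw).
have [Um UmP] := vsp mprod mprod0 mprodP.
pose W := (UZ :\: Um)%VS; pose X := vbasis W.
pose N : 'M[{mpoly k[n]}]_(\dim W, r) := \matrix_(i, j) from X`_i 0 j.
have rowN i : row i N = from X`_i by apply/rowP => j; rewrite !mxE.
have combN (lam : 'rV[k]_(\dim W)) :
    lam%:MX *m N = from (\sum_i lam 0 i *: X`_i).
  rewrite mpoly_comb /from (from_coords_sum xpredT).
  by apply: eq_bigr => i _; rewrite rowN.
have XW (i : 'I_(\dim W)) : X`_i \in W.
  by apply: vbasis_mem; apply: mem_nth; rewrite size_tuple.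
exists (\dim W), N.
  move=> i; rewrite rowN; apply/UZP.
  exact: (subvP (diffvSl UZ Um)).
split=> [z Zz zc|lam lamZ|h].
- have zE : from (to_coords D z) = z by apply: to_coordsK; apply: cD.
  have zU : to_coords D z \in UZ by apply/UZP; rewrite zE.
  move: zU; rewrite -(addv_diff_cap UZ Um) => /memv_addP[w wW [y]].
  rewrite memv_cap => /andP[_ /UmP[my _]] e.
  exists (\row_i coord X i w).
  rewrite combN (_ : \sum_i _ = w); last first.
    rewrite [RHS](coord_vbasis wW); apply: eq_bigr => i _; by rewrite mxE.
  have -> : z - from w = from y; last by [].
  rewrite -zE e; have := fromP 1 w y; rewrite mpolyC1 !scale1r => ->.
  by rewrite addrAC subrr add0r.
- have sW : \sum_i lam 0 i *: X`_i \in W.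
    by apply: memv_suml => i _; apply: memvZ.
  have : \sum_i lam 0 i *: X`_i \in (W :&: Um)%VS.
    rewrite memv_cap sW /=; apply/UmP; rewrite -combN; split=> //.
    by rewrite combN; case/(subvP (diffvSl UZ Um))/UZP: sW.
  rewrite capv_diff memv0 => /eqP lam0; apply/rowP => i; rewrite mxE.
  by have /freeP/(_ (fun i => lam 0 i) lam0 i) := basis_free (vbasisP W).
apply/eqP; rewrite dimv_eq0 -subv0 -(capv_diff UZ Um) subv_cap subvv /=.
apply: subv_trans (diffvSl UZ Um) _; apply/subvP => f /UZP[Zf hf].
by apply/UmP; split=> //; apply: h.
Qed.

Lemma hcomp_const t (e : 'I_t -> lattice_quot L) c (lam : 'rV[k]_t) :
  hcomp e c lam%:MX = (\row_i if e i == c then lam 0 i else 0)%:MX.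
Proof.
apply/rowP => i; rewrite !mxE; apply/mpolyP => m.
rewrite mcoeff_mfilter !mcoeffC; case: (m =P 0%MM) => [->|]; last first.
  by rewrite !mulr0 if_same.
rewrite mdegA0 !mulr1 [0 == _]eq_sym subr_eq0 eq_sym.
by case: ifP.
Qed.

Lemma generators_degrees (B : seq (lattice_quot L)) : uniq B ->
  exists t, exists e : 'I_t -> lattice_quot L,
  exists2 N : 'M[{mpoly k[n]}]_(t, r),
  forall i, [/\ Z (row i N), homog_elt d (e i) (row i N) & e i \in B] &
  [/\ forall c z, c \in B -> Z z -> homog_elt d c z ->
        exists lam : 'rV[k]_t, mprod (z - lam%:MX *m N),
      forall lam : 'rV[k]_t, mprod (lam%:MX *m N) -> lam = 0 &
      (forall c z, Z z -> homog_elt d c z -> mprod z) -> t = 0%N].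
Proof.
elim: B => [_|c B IH /= /andP[cB /IH[t2 [e2 [N2 N2Z [span2 free2 null2]]]]]].
  exists 0%N, (fun=> 0), 0; first by case.
  by split=> // lam _; apply/rowP; case.
have [t1 [N1 N1Z [span1 free1 null1]]] := generators_degree c.
pose e (i : 'I_(t1 + t2)) := match split i with inl _ => c | inr i2 => e2 i2 end.
have el i : e (lshift t2 i) = c by rewrite /e (@unsplitK t1 t2 (inl i)).
have er i : e (rshift t1 i) = e2 i by rewrite /e (@unsplitK t1 t2 (inr i)).
have mprodB v w : mprod v -> mprod w -> mprod (v - w).
  by move=> mv mw; rewrite addrC -scaleN1r; apply: mprodP.
have combE (lam : 'rV[k]_(t1 + t2)) : lam%:MX *m col_mx N1 N2 =
    (lsubmx lam)%:MX *m N1 + (rsubmx lam)%:MX *m N2.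
  by rewrite -{1}[lam]hsubmxK map_row_mx mul_row_col.
have homN : homog_map e d (col_mx N1 N2).
  move=> i; rewrite -[i]splitK; case: (split i) => j /=.
    by rewrite el rowKu; case: (N1Z j).
  by rewrite er rowKd; case: (N2Z j).
exists (t1 + t2)%N, e, (col_mx N1 N2).
  move=> i; split; last 1 first.
  - rewrite -[i]splitK; case: (split i) => j /=; rewrite ?el ?er inE ?eqxx //.
    by case: (N2Z j) => _ _ ->; rewrite orbT.
  - rewrite -[i]splitK; case: (split i) => j /=; rewrite ?rowKu ?rowKd.
      by case: (N1Z j).
    by case: (N2Z j).
  exact: homN.
split=> [c' z|lam lamZ|h]; last by rewrite null1 ?null2 //; apply: h.
- rewrite inE => /orP[/eqP -> Zz zc|c'B Zz zc].
    have [lam lamP] := span1 z Zz zc; exists (row_mx lam 0).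
    by rewrite combE row_mxKl row_mxKr map_mx0 mul0mx addr0.
  have [lam lamP] := span2 c' z c'B Zz zc; exists (row_mx 0 lam).
  by rewrite combE row_mxKl row_mxKr map_mx0 mul0mx add0r.
(* Since [c] is not in [B], the degree-c component of the relation involves only the new block of
   generators. *)
have l1 : lsubmx lam = 0.
  apply: free1; have := mprod_hcomp c lamZ.
  rewrite -(hcomp_mulmx _ _ homN) hcomp_const combE.
  set l := \row_i _; have -> : lsubmx l = lsubmx lam.
    by apply/rowP => i; rewrite !mxE el eqxx.
  have -> : rsubmx l = 0; last by rewrite map_mx0 mul0mx addr0.
  apply/rowP => i; rewrite !mxE er; case: eqP => // e2c.
  by case: (N2Z i) => _ _; rewrite e2c (negPf cB).
rewrite -[lam]hsubmxK l1 (free2 (rsubmx lam)) ?row_mx0 //.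
by move: lamZ; rewrite combE l1 map_mx0 mul0mx add0r.
Qed.

(** Graded Nakayama: outside the finite list [B] there is nothing in Z / m Z, so lifts of bases in
    the degrees of [B] generate Z, and a relation among them has no constant coefficients. The last
    conclusion is what ends the resolution. *)
Lemma minimal_generators (B : seq (lattice_quot L)) :
  (forall c z, c \notin B -> Z z -> homog_elt d c z -> mprod z) ->
  exists t, exists e : 'I_t -> lattice_quot L,
  exists2 N : 'M[{mpoly k[n]}]_(t, r),
  homog_map e d N /\ (forall i, in_semigroup (e i)) &
  [/\ forall v, Z v <-> exists w, v = w *m N,
      forall w : 'rV_t, w *m N = 0 -> forall i, (w 0 i)@_0%MM = 0 &
      (forall c z, Z z -> homog_elt d c z -> mprod z) -> t = 0%N].
Proof.
move=> outB.
have [t [e [N NZ [span indep null]]]] := generators_degrees (undup_uniq B).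
have homN : homog_map e d N by move=> i; case: (NZ i).
have imgZ w : Z (w *m N).
  rewrite mulmx_sum_row; elim/big_rec: _ => // i v _ Zv.
  by apply: ZD Zv; apply: ZM; case: (NZ i).
have spanT c z : Z z -> homog_elt d c z ->
    exists lam : 'rV[k]_t, mprod (z - lam%:MX *m N).
  move=> Zz zc; have [cB|cB] := boolP (c \in B).
    by apply: (span c); rewrite ?mem_undup.
  by exists 0; rewrite map_mx0 mul0mx subr0; apply: (outB c).
(* [m] bounds the total degrees of the monomials of degree [c]. Splitting off a variable lowers the
   bound; at 0 there is no such monomial and z = 0, since the shifts lie in the semigroup. *)
have homogP m c z : (forall u, deg u = c -> (mdeg u < m)%N) -> Z z ->
    homog_elt d c z -> exists w, z = w *m N.
  elim: m c z => [|m IH] c z cm Zz zc.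
    exists 0; rewrite mul0mx; apply/rowP => j; rewrite mxE.
    apply/eqP; rewrite -msupp_eq0; case mE: (msupp (z 0 j)) => [//|x s].
    have /zc : x \in msupp (z 0 j) by rewrite mE mem_head.
    by have [u ->] := dA j; rewrite -mdegAD => /cm.
  have [lam [y yZ ye]] := spanT c z Zz zc.
  have /fin_all_exists[w wP] l : exists w,
      hcomp d (c - deg U_(l)%MM) (y l) = w *m N.
    apply: (IH (c - deg U_(l)%MM)); last exact: hcomp_homog.
      move=> u uc; have : deg (u + U_(l))%MM = c by rewrite mdegAD uc subrK.
      by move/cm; rewrite mdegD mdeg1 addn1 ltnS.
    exact: Zhcomp.
  exists (hcomp e c lam%:MX + \sum_l 'X_l *: w l).
  rewrite mulmxDl (hcomp_mulmx _ _ homN) mulmx_suml.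
  have -> : \sum_l 'X_l *: w l *m N =
      \sum_l 'X_l *: hcomp d (c - deg U_(l)%MM) (y l).
    by apply: eq_bigr => l _; rewrite -scalemxAl wP.
  by rewrite -hcomp_mprodE -ye -hcompD addrC subrK hcomp_id.
exists t, e, N.
  split=> // i; have [_ rc _] := NZ i.
  (* A generator is nonzero by independence modulo m Z, and any monomial in it exhibits its degree
     as an element of the semigroup. *)
  have [j jN] : exists j, row i N 0 j != 0.
    suff /existsP[j jN] : [exists j, row i N 0 j != 0] by exists j.
    apply: contraT => /existsPn h.
    have : (delta_mx 0 i : 'rV[k]_t) = 0.
      apply: indep; rewrite (_ : _ *m N = 0); first exact: mprod0.
      rewrite mpoly_comb big1 // => i' _; rewrite mxE eqxx /=.
      have [->|_] := eqVneq i' i; last by rewrite mpolyC0 scale0r.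
      rewrite mpolyC1 scale1r; apply/rowP => j; rewrite [RHS]mxE.
      by have := h j; rewrite negbK => /eqP.
    move/rowP/(_ i); rewrite !mxE !eqxx /= => /eqP.
    by rewrite oner_eq0.
  have : msupp (row i N 0 j) != [::] by rewrite msupp_eq0.
  case mE: (msupp (row i N 0 j)) => [//|m s] _.
  have /rc <- : m \in msupp (row i N 0 j) by rewrite mE mem_head.
  by apply: in_semigroupD => //; exists m.
split=> [v|w w0 i|h]; last exact: null.
  split=> [Zv|[w ->]]; last exact: imgZ.
  have [s ->] := hcomp_sum d v.
  elim: s => [|c s [w IH]]; first by exists 0; rewrite big_nil mul0mx.
  have [D DP] := height_bound c.
  have [w' w'E] := homogP D c _ DP (Zhcomp c Zv) (@hcomp_homog _ _ _ _ d c v).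
  by exists (w' + w); rewrite big_cons IH w'E mulmxDl.
(* [lam] is the constant part of the relation. The rest of [w] has entries in m, so the combination
   of generators given by [lam] lies in m Z and [lam] = 0. *)
pose lam : 'rV[k]_t := \row_j (w 0 j)@_0%MM.
have /fin_all_exists[y yP] j : exists y : 'I_n -> {mpoly k[n]},
    w 0 j - (lam 0 j)%:MP = \sum_l 'X_l * y l.
  by apply: mcoeff0_sum; rewrite mcoeffB mcoeffC eqxx mulr1 mxE subrr.
have -> : (w 0 i)@_0%MM = lam 0 i by rewrite mxE.
rewrite (indep lam) ?mxE //.
exists (fun l => - (\row_j y j l *m N)) => [l|].
  by rewrite -scaleN1r; apply: ZM; apply: imgZ.
have we : w = lam%:MX + \sum_l 'X_l *: \row_j y j l.
  apply/rowP => j; rewrite mxE summxE; under eq_bigr => l _ do rewrite !mxE.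
  by rewrite -yP mxE addrC subrK.
move: w0; rewrite we mulmxDl mulmx_suml => /eqP; rewrite addr_eq0 => /eqP ->.
by rewrite -sumrN; apply: eq_bigr => l _; rewrite -scalemxAl scalerN.
Qed.
End Generators.

(** * Iterated syzygies *)

Section MinimalResolution.
Variables (k : fieldType) (n : nat) (L : zmodClosed 'rV[int]_n).
Hypothesis hL : pointed_lattice L.
Local Notation deg := (mdegA L).
Local Notation Q := (lattice_quot L).

Record gens r (d : 'I_r -> Q) := Gens {
  gens_rk : nat;
  gens_shift : 'I_gens_rk -> Q;
  gens_mx : 'M[{mpoly k[n]}]_(gens_rk, r);
  gens_in : forall i, in_semigroup (gens_shift i);
  gens_homog : homog_map gens_shift d gens_mx }.

Definition good_gens r (d : 'I_r -> Q) (Z : 'rV[{mpoly k[n]}]_r -> Prop)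
    (g : gens d) :=
  [/\ forall v, Z v <-> exists w, v = w *m gens_mx g,
      forall w : 'rV_(gens_rk g), w *m gens_mx g = 0 ->
        forall i, (w 0 i)@_0%MM = 0 &
      (forall c z, Z z -> homog_elt d c z -> mprod Z z) -> gens_rk g = 0%N].

Definition no_gens r (d : 'I_r -> Q) : gens d.
Proof. by apply: (@Gens r d 0%N (fun=> 0) 0); case. Defined.

(* A junk value unless good generators exist; they always do along [stages], but
   this is only known afterwards, by induction ([res_good]). *)
Definition choose_gens r (d : 'I_r -> Q) Z : gens d :=
  epsilon (inhabits (no_gens d)) (good_gens Z).

(** A stage holds G_i together with the map from G_(i+1), whose kernel is the next module to be
    generated. Bundling the ranks with the matrices lets one type carry the whole iteration. *)
Record stage := Stage {
  stage_rk : nat;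
  stage_shift : 'I_stage_rk -> Q;
  stage_in : forall i, in_semigroup (stage_shift i);
  stage_gens : gens stage_shift }.

Definition next_stage (s : stage) : stage :=
  Stage (@gens_in _ _ (stage_gens s))
    (choose_gens (gens_shift (g:=stage_gens s))
      (fun v => v *m gens_mx (stage_gens s) = 0)).

Lemma zero_in_semigroup : @in_semigroup n L 0.
Proof. by exists 0%MM; rewrite mdegA0. Qed.

Definition stage0 : stage :=
  @Stage 1 (fun=> 0) (fun=> zero_in_semigroup)
    (choose_gens (fun=> 0) (fun v => forall j, lattice_ideal L (v 0 j))).

Definition stages i := iter i next_stage stage0.

Definition res_rk i := stage_rk (stages i).
Definition res_shift i : 'I_(res_rk i) -> Q := @stage_shift (stages i).
Definition res_diff i : 'M[{mpoly k[n]}]_(res_rk i.+1, res_rk i) :=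
  gens_mx (stage_gens (stages i)).

Lemma res_in i j : in_semigroup (@res_shift i j).
Proof. exact: stage_in. Qed.

Lemma res_homog i : homog_map (@res_shift i.+1) (@res_shift i) (res_diff i).
Proof. exact: gens_homog. Qed.

Lemma stage_gensE i : stage_gens (stages i) =
  choose_gens (@res_shift i) (@cycle k n L res_rk res_diff i).
Proof. by case: i. Qed.

(** By pointedness 1 is the only monomial of degree 0, so the constant term is the coefficient sum
    in degree 0. *)
Lemma lattice_ideal_const p : lattice_ideal L p -> (p : {mpoly k[n]})@_0%MM = 0.
Proof.
move/lattice_idealP/(_ 0); rewrite csumE.
have [m0|] := boolP (0%MM \in msupp p); last first.
  by rewrite mcoeff_msupp negbK => /eqP.
rewrite big_mkcond (bigD1_seq 0%MM) ?msupp_uniq //= mdegA0 eqxx big1 ?addr0 //.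
move=> m mn0; case: eqP => // dm; case/eqP: mn0; apply/esym.
apply: (mdegA_antichain hL); first by rewrite dm mdegA0.
by apply/mnm_lepP => l; rewrite mnm0E.
Qed.

Lemma degree_bound (rk : nat -> nat) (sh : forall i, 'I_(rk i) -> Q) b :
  (forall i j, in_semigroup (@sh i j)) ->
  exists D, forall i a (w : 'X_{1..n}), deg w + @sh i a = b -> (mdeg w < D)%N.
Proof.
move=> shA; have [D DP] := height_bound hL b; exists D => i a w.
have [u ->] := shA i a; rewrite -mdegAD => /DP; rewrite mdegD.
by apply: leq_ltn_trans; apply: leq_addr.
Qed.

Lemma fiber_fset b : exists C : {fset 'X_{1..n}}, forall u, u \in C <-> deg u = b.
Proof.
have [s sP] := fiber_finite hL b; exists [fset u in s]%fset => u.
by rewrite inE sP; split=> /eqP.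
Qed.

(** Exactness below a stage makes its homogeneous cycles decomposable wherever the divisor complex
    has no homology, that is, outside finitely many degrees, and in every degree from stage n on,
    where a face would need more than n vertices. *)
Lemma res_good i :
  good_gens (@cycle k n L res_rk res_diff i) (stage_gens (stages i)) /\
  ((n <= i)%N -> res_rk i.+1 = 0%N).
Proof.
elim/ltn_ind: i => N IH.
have ex i : (i < N)%N -> @exact_at k n L res_rk res_diff i.
  by move=> /IH[[h _ _] _].
(* For stage 0 this is pointedness; later it is the minimality of the preceding generators. *)
have cycle_const v : cycle L res_diff v ->
    forall a, ((v : 'rV_(res_rk N)) 0 a)@_0%MM = 0.
  case: N IH ex v => [|N] IH ex v /= cv a; first exact: lattice_ideal_const.
  by have [[_ h _] _] := IH N (leqnn _); apply: h.
have decomp c C z : (forall u, u \in C <-> deg u = c) ->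
    reduced_homology_dim k (divisor_complex C) N = 0%N ->
    cycle L res_diff z -> homog_elt (@res_shift N) c z ->
    mprod (@cycle k n L res_rk res_diff N) z.
  move=> CP h0 cz zc; have [D DP] := degree_bound c res_in.
  apply: (cycle_decomposable (sh := res_shift) _ _ res_homog DP
    (divisor_complexP CP) (@divisor_complex_down n C) ex h0 cz zc) => //.
  exact: cycle_const.
have [B BP] := betti_finite L k N.
have outB c z : c \notin B -> cycle L res_diff z ->
    homog_elt (@res_shift N) c z -> mprod (@cycle k n L res_rk res_diff N) z.
  move=> cB; have [C CP] := fiber_fset c; apply: (decomp c C) => //.
  by apply/eqP; apply: contraNT cB; apply: BP.
have good : good_gens (@cycle k n L res_rk res_diff N) (stage_gens (stages N)).
  rewrite stage_gensE; apply: epsilon_spec.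
  have [||||t [e [M [Mh Me] MP]]] := @minimal_generators k n L hL _ _ (@res_in N)
      (@cycle k n L res_rk res_diff N) _ _ _ _ B outB.
  - exact: cycle0.
  - exact: cycleD.
  - exact: cycleZ.
  - by move=> c v; apply: cycle_hcomp => //; exact: res_homog.
  by exists (Gens Me Mh).
split=> // nN; have [_ _] := good; apply=> c z cz zc.
have [C CP] := fiber_fset c; apply: (decomp c C) => //.
exact: divisor_homology_large.
Qed.

Lemma res_diff_diff i : res_diff i.+1 *m res_diff i = 0.
Proof.
have [[h _ _] _] := res_good i.+1; apply/row_matrixP => a.
by rewrite row_mul row0; apply/h; exists (delta_mx 0 a); rewrite rowE.
Qed.

Definition minimal_resolution : graded_complex k L :=
  GradedComplex res_in res_homog res_diff_diff.

Lemma minimal_resolutionP :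
  minimal_free_resolution (@lattice_ideal k n L) minimal_resolution.
Proof.
split; first split.
- by split.
- by have [[]] := res_good 0.
- by move=> i v; have [[h _ _] _] := res_good i.+1; move/h.
- by exists n => -[//|i] /= ni; have [_] := res_good i; apply.
move=> i v j; apply/irrelevant_idealP.
have [[h _ _] _] := res_good i.
have : cycle L res_diff (v *m res_diff i) by apply/h; exists v.
case: i v j h => [|i] v j h cv; first exact: lattice_ideal_const.
by have [[_ m _] _] := res_good i; apply: m.
Qed.
End MinimalResolution.

(** * Strongly indispensable complexes *)

Lemma scaled_row_const (k : fieldType) n N (M : 'M[{mpoly k[n]}]_N) a x (y : k) :
  ((y%:MP *: row a M) 0 x)@_0%MM = y * (M a x)@_0%MM.
Proof. by rewrite !mxE mcoeffCM. Qed.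

(** The entry at [h] decides: modulo m it is c - c' if the two indices agree, and c, which is
    nonzero, otherwise. *)
Lemma scaled_unit_row_eq (k : fieldType) n N (h h' : 'I_N) (c c' : k) :
  c != 0 ->
  (forall x, ((c%:MP *: row h 1%:M - c'%:MP *: row h' 1%:M
               : 'rV[{mpoly k[n]}]_N) 0 x)@_0%MM = 0) ->
  c%:MP *: row h 1%:M = c'%:MP *: row h' 1%:M :> 'rV[{mpoly k[n]}]_N.
Proof.
move=> c0 /(_ h).
rewrite [X in X@__]mxE [X in (_ + X)@__]mxE mcoeffB !scaled_row_const.
rewrite mxE eqxx mcoeff1 eqxx mulr1 mxE.
have [->|ne] := eqVneq h' h; last first.
  by rewrite mcoeff0 mulr0 subr0 => ce; rewrite ce eqxx in c0.
by rewrite mcoeff1 eqxx mulr1 => /eqP; rewrite subr_eq0 => /eqP ->.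
Qed.

Section Resolutions.
Variables (k : fieldType) (n : nat) (L : zmodClosed 'rV[int]_n).
Hypothesis hL : pointed_lattice L.
Local Notation I := (@lattice_ideal k n L).

Lemma free_resolution_exact (G : graded_complex k L) (hG : free_resolution I G) i :
  @exact_at k n L (rk G) (diff G) i.
Proof.
case: hG => _ ex0 exS; case: i => [|i] v; first exact: ex0.
split=> [/exS //|[w ->]]; by rewrite /= -mulmxA diff_diff mulmx0.
Qed.

(** The right-hand side does not mention the resolution, so a Betti degree seen in one free
    resolution is seen in all. *)
Lemma tor_dimE (G : graded_complex k L) (C : {fset 'X_{1..n}}) b N :
  free_resolution I G -> (forall u, u \in C <-> mdegA L u = b) ->
  tor_dim G N.+1 b = reduced_homology_dim k (divisor_complex C) N.
Proof.
move=> hG CP; have [[rk0 sh0] _ _] := hG.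
have [D DP] := degree_bound hL b (@shift_in _ _ _ G).
rewrite -(tor_strand rk0 sh0 (@diff_homog _ _ _ G) DP (divisor_complexP CP)
  (@divisor_complex_down n C) (free_resolution_exact hG)).
rewrite /tor_dim /tensor_boundaries /=.
rewrite -(mxrank_mul_ker (tensor_part G N.+1 b) (tensor_diff G N)).
by rewrite addKn.
Qed.

Section Minimal.
Variable G : graded_complex k L.
Hypothesis hG : minimal_free_resolution I G.

Lemma minimal_tor_dim i b :
  tor_dim G i.+1 b = \rank (tensor_part G i.+1 b).
Proof.
have t0 j : tensor_diff G j = 0.
  case: hG => _ _ m; apply/matrixP => x y; rewrite [LHS]mxE [RHS]mxE.
  have /irrelevant_idealP := m j (delta_mx 0 x) y.
  by rewrite -rowE mxE.
rewrite /tor_dim /tensor_boundaries /= !t0 mulmx0 mxrank0 subn0.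
by rewrite -[RHS](mxrank_mul_ker _ (0 : 'M_(_, rk G i))) mulmx0 mxrank0 add0n.
Qed.

Lemma minimal_ker_const i (v : 'rV[{mpoly k[n]}]_(rk G i.+1)) :
  v *m diff G i = 0 -> forall j, (v 0 j)@_0%MM = 0.
Proof.
case: hG => -[_ _ ex] _ m /ex[w ->] j.
by apply/irrelevant_idealP; apply: m.
Qed.

Section Basis.
Variable delta : forall j, 'M[{mpoly k[n]}]_(rk G j).
Hypothesis delta2 : forall j, delta j *m delta j = 0.
Hypothesis deltaH : forall j, homog_map (shift G j) (shift G j) (delta j).

Fact unipotent_unit j : 1%:M + delta j \in unitmx.
Proof.
have e : (1%:M + delta j) *m (1%:M - delta j) = 1%:M.
  by rewrite mulmxDl !mulmxBr mul1mx mulmx1 delta2 subr0 mul1mx subrK.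
have [u _] := mulmx1_unit e; exact: u.
Qed.

Fact unipotent_homog j a : exists c,
  homog_elt (shift G j) c (row a (1%:M + delta j)).
Proof.
exists (shift G j a); rewrite raddfD; apply: homog_eltD; last exact: deltaH.
move=> x m; rewrite !mxE; case: eqP => [->|_]; last by rewrite msupp0.
by rewrite msupp1 inE => /eqP ->; rewrite mdegA0 add0r.
Qed.

Definition unipotent_basis : based_complex k L :=
  BasedComplex unipotent_unit unipotent_homog.

(** Changing the basis by 1 + delta, whose inverse is 1 - delta, leaves the complex G itself
    unchanged, so embeddings obtained for different [delta] have the same target and can be
    subtracted. [delta 0 = 0] ensures C_0 = {1}. *)
Lemma unipotent_embedding (F : based_complex k L) :
  strongly_indispensable I F -> delta 0 = 0 ->
  exists w : forall j, 'M[{mpoly k[n]}]_(rk F j, rk G j),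
  [/\ forall j, homog_map (shift F j) (shift G j) (w j),
      forall j, w j.+1 *m diff G j = diff F j *m w j,
      forall j (a : 'I_(rk F j)), exists h : 'I_(rk G j), exists2 c : k, c != 0 &
        row a (homog_basis F j) *m w j = c%:MP *: row h (1%:M + delta j)
    & forall a b, w 0%N a b = 1].
Proof.
move=> [_ indF] delta0; have [[[rk0 _] _ _] _ _] := hG.
have eq0 (x y : 'I_(rk G 0)) : x = y.
  by move: x y; rewrite rk0 => x y; rewrite !ord1.
have [|w [[[wH wC] wB] _ w0]] := indF unipotent_basis hG.
  by move=> a a'; rewrite /= delta0 addr0 mxE (eq0 a a') eqxx.
by exists w; split.
Qed.
End Basis.

Variable F : based_complex k L.
Hypothesis hF : strongly_indispensable I F.

Lemma strongly_indispensable_unique i (E : 'I_(rk F i.+1)) b :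
  homog_elt (shift F i.+1) b (row E (homog_basis F i.+1)) ->
  exists2 h : 'I_(rk G i.+1), shift G i.+1 h = b &
    forall h', leA (shift G i.+1 h') b -> h' = h.
Proof.
move=> hb.
pose d0 j : 'M[{mpoly k[n]}]_(rk G j) := 0.
have d0H j : homog_map (shift G j) (shift G j) (d0 j).
  by move=> a x m; rewrite !mxE msupp0.
have d02 j : d0 j *m d0 j = 0 by rewrite mulmx0.
have [w [wH wC wB w0]] := unipotent_embedding d02 d0H hF (erefl _).
have [h [c c0 hE]] := wB i.+1 E; rewrite addr0 in hE.
have hb' : shift G i.+1 h = b.
  have := hcomp_mulmx b (row E (homog_basis F i.+1)) (wH i.+1).
  rewrite (hcomp_id hb) hE => /esym e.
  have := @hcomp_homog k n L _ (shift G i.+1) b (c%:MP *: row h 1%:M) h 0%MM.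
  rewrite e mcoeff_msupp scaled_row_const mxE eqxx mcoeff1 eqxx mulr1 => /(_ c0).
  by rewrite mdegA0 add0r.
exists h => // h'' [e [u ->] be].
apply/eqP; apply: contraT => h''h.
(* The second basis replaces H = e_h by H + x^u e_h''; indices are compared as
   numbers to avoid a cast along j = i.+1. *)
pose d1 j : 'M[{mpoly k[n]}]_(rk G j) := \matrix_(a, a')
  (if [&& j == i.+1, val a == h & val a' == h''] then 'X_[u] else 0).
have d1H j : homog_map (shift G j) (shift G j) (d1 j).
  move=> a x m; rewrite !mxE; case: ifP => [/and3P[/eqP ej]|]; last by rewrite msupp0.
  subst j => /eqP/val_inj -> /eqP/val_inj ->.
  by rewrite msuppX inE => /eqP ->; rewrite hb' be addrC.
have d12 j : d1 j *m d1 j = 0.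
  apply/matrixP => a a'; rewrite !mxE big1 // => x _; rewrite !mxE.
  case: ifP => [/and3P[_ _ /eqP ->]|]; last by rewrite mul0r.
  case: ifP => [/and3P[_ /eqP/val_inj e' _]|]; last by rewrite mulr0.
  by rewrite e' eqxx in h''h.
have d1_0 j : (j <= i)%N -> d1 j = 0.
  move=> ji; apply/matrixP => a a'; rewrite !mxE; case: eqP => //= ej.
  by rewrite ej ltnn in ji.
have [w' [_ wC' wB' w0']] := unipotent_embedding d12 d1H hF (d1_0 0%N (leq0n i)).
(* Up to degree [i] both bases are the standard one, so both embeddings send each basis vector of F
   to a scaled unit vector; the base case is the normalisation of [w 0]. *)
have ww' j : (j <= i)%N -> w j = w' j.
  elim: j => [|j IH] ji; first by apply/matrixP => a a'; rewrite w0 w0'.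
  have dww : (w j.+1 - w' j.+1) *m diff G j = 0.
    by rewrite mulmxBl wC wC' IH ?subrr // ltnW.
  apply: (can_inj (mulKmx (basis_unit F j.+1))); apply/row_matrixP => a.
  rewrite !row_mul; have [x [y y0 xE]] := wB j.+1 a.
  have [x' [y' _ xE']] := wB' j.+1 a; rewrite d1_0 // in xE'.
  rewrite addr0 in xE; rewrite addr0 in xE'.
  rewrite xE xE'; apply: scaled_unit_row_eq y0 _; rewrite -xE -xE' -mulmxBr.
  by apply: minimal_ker_const; rewrite -mulmxA dww mulmx0.
have dww : (w i.+1 - w' i.+1) *m diff G i = 0.
  by rewrite mulmxBl wC wC' ww' ?subrr.
have [h' [c' c0' hE']] := wB' i.+1 E.
pose x := row E (homog_basis F i.+1) *m (w i.+1 - w' i.+1).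
have xk : x *m diff G i = 0 by rewrite /x -mulmxA dww mulmx0.
have xE : x = c%:MP *: row h 1%:M - c'%:MP *: row h' (1%:M + d1 i.+1).
  by rewrite /x mulmxBr hE hE'.
(* The constant term at [h] must vanish. As h'' differs from [h], the added term x^u e_h'' has no
   entry there, which forces h' = h and c' = c. *)
have := minimal_ker_const xk h.
rewrite xE [X in X@__]mxE [X in (_ + X)@__]mxE mcoeffB.
rewrite !scaled_row_const !mxE eqxx mcoeff1 eqxx mulr1 mcoeffD.
rewrite [val h == h'']eq_sym [val h'' == _](inj_eq val_inj) (negPf h''h).
rewrite !andbF mcoeff0 addr0; have [e'|ne] := eqVneq h' h; last first.
  by rewrite mcoeff0 mulr0 subr0 => ce; rewrite ce eqxx in c0.
rewrite mcoeff1 eqxx mulr1 => /eqP; rewrite subr_eq0 => /eqP cc'.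
have xd : x = 'X_[u] *: (- c%:MP *: delta_mx 0 h'').
  rewrite xE -cc' e'; apply/rowP => a; rewrite !mxE !eqxx /= (inj_eq val_inj).
  rewrite mulrDr opprD addrA subrr add0r [in RHS]mulrCA.
  by case: eqP => _; rewrite ?mulr0 ?mulr1 ?oppr0 ?mulNr //.
(* What remains is - c x^u e_h''. Cancelling x^u leaves a cycle with constant coefficient - c at
   h'', against minimality. *)
have : cycle L (diff G) (x : 'rV_(rk G i.+1)) by [].
rewrite xd => /cycle_divX /= /minimal_ker_const /(_ h'').
rewrite !mxE !eqxx /= mulr1 mcoeffN mcoeffC eqxx mulr1 => /eqP.
by rewrite oppr_eq0 (negPf c0).
Qed.
End Minimal.
End Resolutions.

Theorem theorem4p6 (k : fieldType) (n : nat) (L : zmodClosed 'rV[int]_n)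
    (hL : pointed_lattice L) (F : based_complex k L)
    (hF : strongly_indispensable (@lattice_ideal k n L) F)
    (i : nat) (E : 'I_(rk F i.+1)) (b : lattice_quot L)
    (hb : homog_elt (shift F i.+1) b (row E (homog_basis F i.+1))) :
  gcd_homology_dim_eq k b i 1 /\
  minimal_betti_degree (@lattice_ideal k n L) i.+1 b.
Proof.
pose G := minimal_resolution k hL.
have hG : minimal_free_resolution _ G := minimal_resolutionP k hL.
have [hGf _ _] := hG.
have [h hbE uniq_h] := strongly_indispensable_unique hG hF hb.
(* By minimality Tor counts the generators of degree [b]. Each of them has degree at most [b], so it
   is the generator [h]. *)
have torb : tor_dim G i.+1 b = 1%N.
  rewrite minimal_tor_dim // /tensor_part.
  have -> : \row_j (shift G i.+1 j == b)%:R = delta_mx 0 h :> 'rV[k]_(rk G i.+1).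
    apply/rowP => j; rewrite !mxE eqxx /=; congr (nat_of_bool _)%:R.
    apply/eqP/eqP => [jb|->//]; apply: uniq_h.
    by exists 0; [exact: zero_in_semigroup | rewrite addr0; exact: esym jb].
  have -> : diag_mx (delta_mx 0 h) = delta_mx h h :> 'M[k]_(rk G i.+1).
    apply/matrixP => x y; rewrite !mxE eqxx /=.
    case: (x =P y) => [<-|xy]; first by rewrite andbb mulr1n.
    rewrite mulr0n; case: (x =P h) => //= xh; case: (y =P h) => // yh.
    by case: xy; rewrite xh yh.
  by rewrite mxrank_delta.
split.
  have [C CP] := fiber_fset hL b; exists C => //.
  by rewrite gcd_homologyE -(tor_dimE hL _ hGf CP).
split; first by split; [rewrite -hbE; exact: shift_in | exists G; rewrite ?torb].
move=> c [_ [G' hG' torc]] cb; have [C CP] := fiber_fset hL c.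
(* The Betti degree [c] comes with its own resolution G'. Passing through the divisor complex of [c]
   transfers it to G, where it is the degree of a generator, and uniqueness below [b] applies. *)
rewrite (tor_dimE hL _ hG' CP) -(tor_dimE hL _ hGf CP) in torc.
rewrite minimal_tor_dim // in torc.
have [j jc] : exists j, shift G i.+1 j = c.
  suff /existsP[j /eqP jc] : [exists j, shift G i.+1 j == c] by exists j.
  apply: contraT => /existsPn nj; case/eqP: torc; rewrite /tensor_part.
  rewrite (_ : \row_j _ = 0) ?linear0 ?mxrank0 //.
  by apply/rowP => j; rewrite !mxE (negPf (nj j)).
by rewrite -jc (uniq_h j) // jc.
Qed.
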